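(* Let $n>1$, $\mathcal D=(0,1)^n$, integers $\ell_0\ge2$ and $L>\ell_0$, and constants $\eta,\rho\in\mathbb R$, $\boldsymbol\beta\in\mathbb R^n$. Let $a(u,v)=\int_{\mathcal D}(\eta\nabla u\cdot\overline{\nabla v}+\boldsymbol\beta\cdot\nabla u\,\bar v+\rho u\bar v)$ and $\mu_{\mathbf q}=\sup_{\mathbf j\in\mathcal J^{\rm iso}}|a(\widehat\psi^{\rm iso}_{\mathbf j},\widehat\xi_{\mathbf q})|^2$, $\mathbf q\in\mathbb Z^n$ (see context). Then $$\mu_{\mathbf 0}\lesssim|\rho|^2 2^{-(2+n)\ell_0},$$ and for all $\mathbf q\ne\mathbf 0$, $$\mu_{\mathbf q}\lesssim\Big(|\eta|^2+\frac{\|\boldsymbol\beta\|_2^2}{\|\mathbf q\|_2^2}+\frac{|\rho|^2}{\|\mathbf q\|_2^4}\Big)\min\Big\{\frac{(1+2^{2(-\frac n2+2\|\mathbf q\|_0-1)L})\|\mathbf q\|_2^2}{|\widehat{\mathbf q}|^{\mathbf 4}},\ \frac{2^{-(n-\|\mathbf q\|_0)\ell_0}\|\mathbf q\|_2^2}{\|\mathbf q\|_\infty^2|\widehat{\mathbf q}|^{\mathbf 1}}\Big\},$$ with hidden constants depending exponentially on $n$ (and not on $\mathbf q$, $L$ or the coefficients).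
   Context: 1D functions: $\varphi(x)=\max\{0,1-|x|\}$, $\psi(x)=\sum_{j=-1}^3b_j\varphi(2x-j)$ with $(b_{-1},\dots,b_3)=(\tfrac14,\tfrac12,-\tfrac32,\tfrac12,\tfrac14)$ (biorthogonal B-spline wavelets of order $(2,2)$), $\varphi_{\ell,k}=2^{\ell/2}\varphi(2^\ell\cdot-k)$, $\psi_{\ell,k}=2^{\ell/2}\psi(2^\ell\cdot-k)$, 1-periodized ($f^{\rm per}(x)=\sum_jf(x+j)$) on $(0,1)$. $\vartheta_{\ell,k,0}=\varphi_{\ell,k}$, $\vartheta_{\ell,k,1}=\psi_{\ell,k}$, $\psi^{\rm iso}_{\ell,\mathbf k,\mathbf e}(\mathbf x)=\prod_j\vartheta_{\ell,k_j,e_j}(x_j)$, indexed by $\mathbf j=(\ell,\mathbf k,\mathbf e)\in\mathcal J^{\rm iso}=\{\ell\in\mathbb N,\ \ell_0\le\ell<L,\ \mathbf k\in(\mathbb Z/(2^\ell\mathbb Z))^n,\ \mathbf e\in\{0,1\}^n\}$, normalized $\widehat\psi^{\rm iso}_{\mathbf j}=2^{-\ell}\psi^{\rm iso}_{\mathbf j}$. $\xi_{\mathbf q}(\mathbf x)=e^{2\pi i\mathbf q\cdot\mathbf x}$, $\widehat\xi_{\mathbf q}=(1+(2\pi\|\mathbf q\|_2)^2)^{-1/2}\xi_{\mathbf q}$. Notation: $\|\mathbf q\|_0$ = number of nonzero entries, $\widehat{\mathbf q}$ = restriction to nonzero entries, $|\mathbf x|^{\mathbf y}=\prod_j|x_j|^{y_j}$,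 $\mathbf 1,\mathbf 4$ constant vectors. *)

(* Defs.v *)
From HB Require Import structures.
From mathcomp Require Import all_boot all_order all_algebra.
From mathcomp Require Import all_classical all_reals all_analysis.
From mathcomp.real_closed Require Import complex.

Set Implicit Arguments.
Unset Strict Implicit.
Unset Printing Implicit Defensive.

Import Order.TTheory GRing.Theory Num.Theory.
Local Open Scope ring_scope.
Local Open Scope complex_scope.

Section WaveletDefs.
Variable R : realType.

Definition phi (x : R) : R := Num.max 0 (1 - `|x|).

Definition psi (x : R) : R :=
  4^-1 * phi (2 * x + 1) + 2^-1 * phi (2 * x)
  - (3 / 2) * phi (2 * x - 1) + 2^-1 * phi (2 * x - 2)
  + 4^-1 * phi (2 * x - 3).

Definition phi_lk (l : nat) (k : int) (x : R) : R :=
  Num.sqrt (2 ^+ l) * phi (2 ^+ l * x - k%:~R).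
Definition psi_lk (l : nat) (k : int) (x : R) : R :=
  Num.sqrt (2 ^+ l) * psi (2 ^+ l * x - k%:~R).

(* 1-periodization f^per(x) = sum_{j in Z} f(x + j),
   the sum over Z being the limit of the symmetric partial sums
   sum_{j=-N}^{N-1} f(x+j). *)
Definition per (f : R -> R) (x : R) : R :=
  limn (fun N : nat => \sum_(0 <= j < N) (f (x + j%:R) + f (x - j.+1%:R))).

Definition theta (l : nat) (k : int) (e : bool) : R -> R :=
  per (if e then psi_lk l k else phi_lk l k).

Definition psi_iso (n l : nat) (k : 'I_n -> int) (e : 'I_n -> bool)
  (x : 'I_n -> R) : R :=
  \prod_(i < n) theta l (k i) (e i) (x i).

Definition psi_iso_hat (n l : nat) (k : 'I_n -> int) (e : 'I_n -> bool)
  (x : 'I_n -> R) : R[i] :=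
  ((2 ^+ l)^-1 * psi_iso l k e x)%:C.

Definition qnorm2sq (n : nat) (q : 'I_n -> int) : R :=
  \sum_(i < n) ((q i)%:~R) ^+ 2.

Definition xi (n : nat) (q : 'I_n -> int) (x : 'I_n -> R) : R[i] :=
  let t := 2 * pi * \sum_(i < n) (q i)%:~R * x i in
  (cos t +i* sin t)%C.

Definition xi_hat (n : nat) (q : 'I_n -> int) (x : 'I_n -> R) : R[i] :=
  ((Num.sqrt (1 + (2 * pi) ^+ 2 * qnorm2sq q))^-1)%:C * xi q x.

Definition upd (n : nat) (x : 'I_n -> R) (j : 'I_n) (t : R) : 'I_n -> R :=
  fun i => if i == j then t else x i.

Definition pd (n : nat) (j : 'I_n) (F : ('I_n -> R) -> R[i]) (x : 'I_n -> R)
  : R[i] :=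
  ((derive1 (fun t => complex.Re (F (upd x j t))) (x j)) +i*
   (derive1 (fun t => complex.Im (F (upd x j t))) (x j)))%C.

(* iterated Lebesgue integral over (0,1)^m of f, integrating the
   coordinates 0, ..., m-1 (the other coordinates are set to 0) *)
Fixpoint iint (m : nat) (f : (nat -> R) -> R) : R :=
  match m with
  | 0 => f (fun _ => 0)
  | m'.+1 =>
      \int[@lebesgue_measure R]_(t in `]0, 1[%classic)
        iint m' (fun y => f (fun i => if i == m' then t else y i))
  end.

Definition intD (n : nat) (F : ('I_n -> R) -> R) : R :=
  iint n (fun y => F (fun i : 'I_n => y (val i))).

Definition cintD (n : nat) (F : ('I_n -> R) -> R[i]) : R[i] :=
  (intD (fun x => complex.Re (F x)) +i* intD (fun x => complex.Im (F x)))%C.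

Definition aform (n : nat) (eta : R) (beta : 'I_n -> R) (rho : R)
  (u v : ('I_n -> R) -> R[i]) : R[i] :=
  cintD (fun x =>
    eta%:C * (\sum_(i < n) pd i u x * conjc (pd i v x))
    + (\sum_(i < n) (beta i)%:C * pd i u x) * conjc (v x)
    + rho%:C * u x * conjc (v x)).

Definition qnorm0 (n : nat) (q : 'I_n -> int) : nat :=
  #|[set i : 'I_n | q i != 0%R]|.

Definition qnorminf (n : nat) (q : 'I_n -> int) : R :=
  \big[Num.max/0]_(i < n) `|(q i)%:~R : R|.

(* |hat q|^{y} for the constant vector y = (p, ..., p) *)
Definition qhatpow (n : nat) (q : 'I_n -> int) (p : nat) : R :=
  \prod_(i < n | q i != 0%R) `|(q i)%:~R : R| ^+ p.

Definition rnorm2sq (n : nat) (b : 'I_n -> R) : R := \sum_(i < n) b i ^+ 2.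

(* the index set J^iso: l0 <= l < L, k in (Z/2^l Z)^n (represented by
   0 <= k_i < 2^l), e in {0,1}^n *)
Definition Jiso (n l0 L l : nat) (k : 'I_n -> int) : Prop :=
  (l0 <= l < L)%N /\ forall i, (0 <= k i)%R /\ (k i < (2 ^ l)%:Z)%R.

(* mu_q <= B, i.e. sup_{j in J^iso} |a(hat psi_j, hat xi_q)|^2 <= B *)
Definition mu_le (n l0 L : nat) (eta : R) (beta : 'I_n -> R) (rho : R)
  (q : 'I_n -> int) (B : R) : Prop :=
  forall (l : nat) (k : 'I_n -> int) (e : 'I_n -> bool), Jiso l0 L l k ->
    ComplexField.Normc.normc (aform eta beta rho (psi_iso_hat l k e) (xi_hat q)) ^+ 2 <= B.

End WaveletDefs.

(* Main.v *)
Require Import Defs.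
From HB Require Import structures.
From mathcomp Require Import all_boot all_order all_algebra.
From mathcomp Require Import all_classical all_reals all_analysis.
From mathcomp.real_closed Require Import complex.
From mathcomp Require Import measurable_realfun ring lra.
Import Order.TTheory GRing.Theory Num.Theory.
Import numFieldNormedType.Exports.
Local Open Scope ring_scope.
Local Open Scope complex_scope.

(** Every factor of the integrand is a function of one coordinate, so the
    iterated integral splits; integration by parts in each periodic coordinate
    then gives, with [c_j] the [q_j]-th Fourier coefficient of [theta_j],
      [a(psi_hat, xi_hat) = 2^-l (1 + (2 pi)^2 |q|^2)^(-1/2)
         ((2 pi)^2 eta |q|^2 + rho + 2 pi i (beta . q)) prod_j c_j].
    On [(0,1)] each [theta_j] is a combination of hinges [max(0, x - a)] with
    equal values at [0] and [1] and total weight [O(2^(3l/2))]; two integrations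
    by parts give [|c_j|^2 q_j^4 = O(2^(3l))], and the size of the support gives
    [|c_j|^2 = O(2^-l)].  The first bound in every nonzero direction yields the
    first term of the minimum; interpolating both, with the stronger decay
    [|q_i|^-3] spent on a maximal entry [q_i], yields the second. *)

(** * Bounded measurable functions on the unit interval *)

Section UnitInterval.
Context {R : realType}.
Implicit Types (f g F : R -> R) (a b x : R).

Definition I01 f : R := \int[@lebesgue_measure R]_(x in `]0%R, 1%R[%classic) f x.

(** Bounded measurable functions form an algebra contained in the integrable functions on []0, 1[].
    Working in this class reduces every integrability condition below to closure under sums and
    products. *)
Definition bmeas f : Prop :=
  measurable_fun (`]0, 1[%classic : set R) f /\
  exists M : R, forall x, 0 < x < 1 -> `|f x| <= M.

Lemma mem01 x : (`]0%R, 1%R[%classic : set R) x <-> 0 < x < 1.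
Proof. by rewrite /= in_itv. Qed.

Lemma bmeas_integrable f : bmeas f ->
  (@lebesgue_measure R).-integrable `]0%R, 1%R[%classic (EFin \o f).
Proof.
move=> [mf [M hM]]; apply: measurable_bounded_integrable => //.
  by rewrite /= lebesgue_measure_itv /= lte_fin ltr01 oppr0 adde0 ltry.
exists M; split; first exact: num_real.
by move=> y My x /mem01 hx; apply: le_trans (ltW My); exact: hM.
Qed.

Lemma eq_I01 f g : (forall x, 0 < x < 1 -> f x = g x) -> I01 f = I01 g.
Proof.
by move=> fg; apply: eq_Rintegral => x; rewrite inE => /mem01; exact: fg.
Qed.

Lemma eq_bmeas f g : (forall x, 0 < x < 1 -> f x = g x) -> bmeas f -> bmeas g.
Proof.
move=> fg [mf [M hM]]; split.
  apply: eq_measurable_fun mf => x; rewrite inE => /mem01; exact: fg.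
by exists M => x hx; rewrite -fg // hM.
Qed.

Lemma bmeas_continuous f : continuous f -> bmeas f.
Proof.
move=> cf; split.
  by apply: measurable_funTS; exact: continuous_measurable_fun.
have [c _ hc] : exists2 c, c \in `[0%R, 1%R] &
    forall t, t \in `[0%R, 1%R] -> `|f t| <= `|f c|.
  apply: (@EVT_max R (fun x => `|f x|)) => //.
  apply: continuous_subspaceT => x; apply: continuous_comp; first exact: cf.
  exact: norm_continuous.
exists `|f c| => x /andP[x0 x1]; apply: hc.
by rewrite in_itv /= !ltW.
Qed.

Lemma bmeas_cst (c : R) : bmeas (fun=> c).
Proof. by apply: bmeas_continuous => x; exact: cvg_cst. Qed.

Lemma bmeasD f g : bmeas f -> bmeas g -> bmeas (fun x => f x + g x).
Proof.
move=> [mf [M hM]] [mg [N hN]]; split; first exact: measurable_funD.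
exists (M + N) => x hx; apply: le_trans (ler_normD _ _) _.
by apply: lerD; [exact: hM|exact: hN].
Qed.

Lemma bmeasM f g : bmeas f -> bmeas g -> bmeas (fun x => f x * g x).
Proof.
move=> [mf [M hM]] [mg [N hN]]; split; first exact: measurable_funM.
exists (M * N) => x hx; rewrite normrM.
by apply: ler_pM => //; [exact: hM|exact: hN].
Qed.

Lemma bmeasZ (c : R) f : bmeas f -> bmeas (fun x => c * f x).
Proof. by apply: bmeasM; exact: bmeas_cst. Qed.

Lemma bmeasN f : bmeas f -> bmeas (fun x => - f x).
Proof.
by move=> hf; apply: eq_bmeas (bmeasZ (-1) _ hf) => x _; rewrite mulN1r.
Qed.

Lemma bmeasB f g : bmeas f -> bmeas g -> bmeas (fun x => f x - g x).
Proof. by move=> hf hg; apply: bmeasD => //; exact: bmeasN. Qed.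

Lemma bmeas_sum (T : Type) (s : seq T) (h : T -> R -> R) :
  (forall t, bmeas (h t)) -> bmeas (fun x => \sum_(t <- s) h t x).
Proof.
move=> hh; elim: s => [|t s IH].
  by apply: eq_bmeas (bmeas_cst 0) => x _; rewrite big_nil.
by apply: eq_bmeas (bmeasD _ _ (hh t) IH) => x _; rewrite big_cons.
Qed.

Lemma I01D f g : bmeas f -> bmeas g -> I01 (fun x => f x + g x) = I01 f + I01 g.
Proof. by move=> hf hg; apply: RintegralD => //; exact: bmeas_integrable. Qed.

Lemma I01Z (c : R) f : bmeas f -> I01 (fun x => c * f x) = c * I01 f.
Proof. by move=> hf; apply: RintegralZl => //; exact: bmeas_integrable. Qed.

Lemma I01N f : bmeas f -> I01 (fun x => - f x) = - I01 f.
Proof.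
move=> hf; rewrite -mulN1r -I01Z //.
by apply: eq_I01 => x _; rewrite mulN1r.
Qed.

Lemma I01B f g : bmeas f -> bmeas g -> I01 (fun x => f x - g x) = I01 f - I01 g.
Proof. by move=> hf hg; rewrite I01D ?I01N //; exact: bmeasN. Qed.

Lemma I01_0 : I01 (fun=> 0) = 0.
Proof.
rewrite (eq_I01 _ (fun x => 0 * 0)); last by move=> x _; rewrite mul0r.
by rewrite (I01Z 0 _ (bmeas_cst 0)) mul0r.
Qed.

Lemma I01_sum (T : Type) (s : seq T) (h : T -> R -> R) :
  (forall t, bmeas (h t)) ->
  I01 (fun x => \sum_(t <- s) h t x) = \sum_(t <- s) I01 (h t).
Proof.
move=> hh; elim: s => [|t s IH].
  by rewrite big_nil -[RHS]I01_0; apply: eq_I01 => x _; rewrite big_nil.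
rewrite big_cons -IH -I01D //; last exact: bmeas_sum.
by apply: eq_I01 => x _; rewrite big_cons.
Qed.

Lemma le_I01 f g : bmeas f -> bmeas g ->
  (forall x, 0 < x < 1 -> f x <= g x) -> I01 f <= I01 g.
Proof.
move=> hf hg fg; apply: le_Rintegral => //; exact: bmeas_integrable.
Qed.

Lemma le_norm_I01 f g : bmeas f -> bmeas g ->
  (forall x, 0 < x < 1 -> `|f x| <= g x) -> `|I01 f| <= I01 g.
Proof.
move=> hf hg fg.
have h1 : I01 f <= I01 g.
  by apply: le_I01 => // x hx; apply: le_trans (fg _ hx); exact: ler_norm.
have h2 : - I01 f <= I01 g.
  rewrite -I01N //; apply: le_I01 => //; first exact: bmeasN.
  by move=> x hx; apply: le_trans (fg _ hx); rewrite -normrN; exact: ler_norm.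
by rewrite ler_norml h1 andbT lerNl.
Qed.

(** On the interval [f] is [g] plus a multiple of the indicator of the null set [[set a]].
    Measurability of [f] is a conclusion, so the lemma applies to a derivative known only off its
    breakpoints. *)
Lemma eq_off1_I01 (a : R) f g : (forall x, 0 < x < 1 -> x != a -> f x = g x) ->
  bmeas g -> bmeas f /\ I01 f = I01 g.
Proof.
move=> fg hg.
have hi : bmeas (\1_[set a] : R -> R).
  split; first exact: measurable_funTS (measurable_indic _).
  by exists 1 => x _; rewrite indicE; case: (_ \in _); rewrite ?normr1 ?normr0.
have Ii : I01 (\1_[set a]) = 0.
  rewrite /I01 /Rintegral /=.
  rewrite integral_indic //=.
  suff -> : @lebesgue_measure R ([set a] `&` `]0%R, 1%R[)%classic = 0%E by [].
  apply: countable_lebesgue_measure0; apply: sub_countable (countable1 a).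
  by apply: subset_card_le; exact: subIsetl.
have E x : 0 < x < 1 -> g x + (f a - g a) * \1_[set a] x = f x.
  move=> hx; rewrite indicE; have [->|ne] := eqVneq x a.
    by rewrite mem_set //= mulr1; ring.
  rewrite memNset /= ?mulr0 ?addr0 ?fg //.
  by move=> xa; move: ne; rewrite xa eqxx.
split; first by apply: eq_bmeas E _; exact: bmeasD (bmeasZ _ _ hi).
by rewrite -(eq_I01 _ _ E) I01D ?I01Z ?Ii ?mulr0 ?addr0 //; exact: bmeasZ.
Qed.

Lemma eq_off_seq_I01 (s : seq R) f g :
  (forall x, 0 < x < 1 -> x \notin s -> f x = g x) ->
  bmeas g -> bmeas f /\ I01 f = I01 g.
Proof.
elim: s g => [|a s IH] g fg hg.
  have fg' x : 0 < x < 1 -> f x = g x by move=> hx; exact: fg.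
  split; last exact: eq_I01.
  by apply: eq_bmeas hg => x hx; rewrite fg'.
(* Patching [g] at [a] makes it agree with [f] there, so [f] and [g'] differ at most on the shorter
   list [s]. *)
pose g' x := if x == a then f a else g x.
have [hg' Ig'] : bmeas g' /\ I01 g' = I01 g.
  by apply: (eq_off1_I01 a) => // x _ /negPf; rewrite /g' => ->.
rewrite -Ig'; apply: IH => // x hx xs.
rewrite /g'; have [->//|xa] := eqVneq x a.
by apply: fg => //; rewrite inE negb_or xa.
Qed.

(** The projection of a breakpoint onto [[0, 1]]: it is the effective lower limit of integration for
    a function cut off at [a], wherever [a] lies. *)
Definition clamp a : R := Num.max 0 (Num.min 1 a).

Lemma clampP a : [\/ a <= 0 /\ clamp a = 0, 0 <= a /\ a <= 1 /\ clamp a = a |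
  1 <= a /\ clamp a = 1].
Proof.
rewrite /clamp; case: (leP 1 a) => h1.
  by apply: Or33; split => //; apply: max_r; exact: ler01.
case: (leP 0 a) => h2; first by apply: Or32; rewrite ltW.
by apply: Or31; rewrite ltW.
Qed.

Lemma clamp_bound a : 0 <= clamp a <= 1.
Proof. by case: (clampP a) => [[? ->]|[? [? ->]]|[? ->]]; apply/andP; split => //; lra. Qed.

Definition cutoff a f : R -> R := fun x => if a < x then f x else 0.

Lemma bmeas_cutoff a f : bmeas f -> bmeas (cutoff a f).
Proof.
move=> hf; have h1 : bmeas (\1_`]a, +oo[%classic : R -> R).
  split; first exact: measurable_funTS (measurable_indic _).
  by exists 1 => x _; rewrite indicE; case: (_ \in _); rewrite ?normr1 ?normr0.
apply: eq_bmeas (bmeasM _ _ h1 hf) => x _.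
rewrite indicE /cutoff; case: ifPn => ax.
  by rewrite mem_set ?mul1r //= in_itv /= ax.
by rewrite memNset ?mul0r //= in_itv /= andbT; exact/negP.
Qed.

Lemma I01_cutoff a f F : continuous f -> (forall x, is_derive x 1 F (f x)) ->
  I01 (cutoff a f) = F 1 - F (clamp a).
Proof.
move=> cf dF; have /andP[c0 c1] := clamp_bound a.
have -> : I01 (cutoff a f) =
    \int[@lebesgue_measure R]_(x in `](clamp a), 1[%classic) f x.
  have -> : `](clamp a), 1[%classic = (`]0, 1[ `&` `]a, +oo[)%classic :> set R.
    apply/seteqP; split => x /=; rewrite !in_itv /= andbT.
      case: (clampP a) => [[? ->]|[? [? ->]]|[? ->]] /andP[? ?];
        by split; [apply/andP; split|]; lra.
    case: (clampP a) => [[? ->]|[? [? ->]]|[? ->]] [/andP[? ?] ?];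
      by apply/andP; split; lra.
  rewrite Rintegral_mkcondr; apply: eq_Rintegral => x _.
  by rewrite patchE /cutoff mem_setE in_itv /= andbT.
(* If [clamp a] is 1, the domain is empty and both sides vanish; otherwise the fundamental theorem
   applies on a nondegenerate interval. *)
move: c1; rewrite le_eqVlt => /predU1P[->|c1].
  by rewrite set_itvoo0 // Rintegral_set0 subrr.
have hi : (@lebesgue_measure R).-integrable `[clamp a, 1]%classic (EFin \o f).
  apply: continuous_compact_integrable; first exact: segment_compact.
  exact: continuous_subspaceT.
rewrite Rintegral_itv_bndo_bndc; last first.
  by apply: integrableS hi => //; apply: subset_itv; rewrite bnd_simp.
rewrite Rintegral_itv_obnd_cbnd; last first.
  by apply: integrableS hi => //; apply: subset_itv; rewrite bnd_simp.
have cF : continuous F.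
  move=> x; apply: differentiable_continuous; apply/derivable1_diffP.
  by have [] := dF x.
rewrite /Rintegral (continuous_FTC2 (F := F)) //.
- exact: continuous_subspaceT.
- split.
  + by move=> x _; have [] := dF x.
  + exact: cvg_at_right_filter (cF _).
  + exact: cvg_at_left_filter (cF _).
- by move=> x _; rewrite derive1E; have [_ ->] := dF x.
Qed.

End UnitInterval.

(** * Trigonometric integrals of hinge functions *)

Section Hinges.
Context {R : realType}.
Implicit Types (f g F : R -> R) (a b x w : R) (s : seq (R * R)).

Lemma cos_2piz (q : int) : cos (2 * pi * q%:~R : R) = 1.
Proof.
have key (n : nat) : cos (2 * pi * n%:R : R) = 1 /\ sin (2 * pi * n%:R : R) = 0.
  elim: n => [|n [c0 s0]]; first by rewrite mulr0 cos0 sin0.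
  have -> : 2 * pi * n.+1%:R = 2 * pi * n%:R + pi *+ 2 :> R.
    by rewrite -natr1 mulr2n; ring.
  by split; [rewrite cosD|rewrite sinD]; rewrite c0 s0 cos2pi sin2pi; ring.
case: q => n; first by have [] := key n.
rewrite NegzE mulrNz mulrN cosN; by have [] := key n.+1.
Qed.

Lemma sin_2piz (q : int) : sin (2 * pi * q%:~R : R) = 0.
Proof.
apply/eqP; rewrite -sqrf_eq0; apply/eqP.
by have := cos2Dsin2 (2 * pi * q%:~R : R); rewrite cos_2piz; lra.
Qed.

Lemma is_derive_cosM w x :
  is_derive x 1 (fun y => cos (w * y)) (- (w * sin (w * x))).
Proof.
have h : is_derive x (1 : R) (fun y => w * y) w.
  by apply: is_derive_eq; rewrite [LHS]mulr1.
have := @is_derive1_comp R cos (fun y => w * y) x _ _ (is_derive_cos _) h.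
by move=> /is_derive_eq; apply; rewrite mulNr mulrC.
Qed.

Lemma is_derive_sinM w x :
  is_derive x 1 (fun y => sin (w * y)) (w * cos (w * x)).
Proof.
have h : is_derive x (1 : R) (fun y => w * y) w.
  by apply: is_derive_eq; rewrite [LHS]mulr1.
have := @is_derive1_comp R sin (fun y => w * y) x _ _ (is_derive_sin _) h.
by move=> /is_derive_eq; apply; rewrite mulrC.
Qed.

Lemma continuous_cosM w : continuous (fun y => cos (w * y)).
Proof.
move=> x; apply: (continuous_comp (f := fun y => w * y)).
  exact: mulrl_continuous.
exact: continuous_cos.
Qed.

Lemma continuous_sinM w : continuous (fun y => sin (w * y)).
Proof.
move=> x; apply: (continuous_comp (f := fun y => w * y)).
  exact: mulrl_continuous.
exact: continuous_sin.
Qed.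

(** Hinges generate the continuous piecewise linear functions, and their derivatives are the unit
    steps [cutoff a (fun=> 1)]. *)
Definition hinge a x : R := Num.max 0 (x - a).

Lemma hingeE a x : hinge a x = cutoff a (fun y => y - a) x.
Proof. by rewrite /hinge /cutoff -subr_gt0 maxEge; case: ltP => //; case: ltP. Qed.

Lemma hinge_clamp a : hinge a 1 - hinge a 0 = 1 - clamp a.
Proof.
rewrite /hinge; case: (clampP a) => [[? ->]|[? [? ->]]|[? ->]].
- by rewrite !max_r; lra.
- by rewrite max_r ?max_l; lra.
- by rewrite !max_l; lra.
Qed.

Lemma continuous_subC a : continuous (fun y => y - a).
Proof. by move=> x; apply: cvgB; [exact: cvg_id|exact: cvg_cst]. Qed.

Lemma bmeas_hinge a : bmeas (hinge a).
Proof.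
apply: (@eq_bmeas _ (cutoff a (fun y => y - a))); first by move=> *; rewrite hingeE.
exact: bmeas_cutoff _ _ (bmeas_continuous _ (continuous_subC _)).
Qed.

(** Integration by parts with the primitive [(y - a) * sin (w * y)]. The boundary terms vanish: at 1
    and at a lower limit 0 or 1 the sine is zero, and at the lower limit [a] the linear factor is
    zero. Keeping [w] as a factor, instead of dividing by it, covers [q = 0]. *)
Lemma I01_hinge_cos (q : int) a : let w := 2 * pi * q%:~R in
  w * I01 (fun x => hinge a x * cos (w * x)) =
  - I01 (cutoff a (fun x => sin (w * x))).
Proof.
move=> w; set f := fun x => w * ((x - a) * cos (w * x)) + sin (w * x).
have cf : continuous f.
  move=> x; apply: cvgD; last exact: continuous_sinM.
  apply: cvgM; first exact: cvg_cst.
  by apply: cvgM; [exact: continuous_subC|exact: continuous_cosM].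
have dF x : is_derive x 1 (fun y => (y - a) * sin (w * y)) (f x).
  have h1 : is_derive x (1 : R) (fun y => y - a) 1.
    by apply: is_derive_eq; rewrite subr0.
  have h2 := is_derive_sinM w x.
  by apply: is_derive_eq; rewrite /f /GRing.scale /=; ring.
have := I01_cutoff a f _ cf dF.
have -> : I01 (cutoff a f) = w * I01 (fun x => hinge a x * cos (w * x)) +
    I01 (cutoff a (fun x => sin (w * x))).
  have h1 : bmeas (fun x => hinge a x * cos (w * x)).
    apply: bmeasM (bmeas_hinge _) _; exact: bmeas_continuous _ (continuous_cosM _).
  have h2 : bmeas (cutoff a (fun x => sin (w * x))).
    exact: bmeas_cutoff _ _ (bmeas_continuous _ (continuous_sinM _)).
  rewrite -I01Z // -I01D //; last exact: bmeasZ.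
  apply: eq_I01 => x _; rewrite hingeE /cutoff /f.
  by case: ifP; rewrite ?mul0r ?mulr0 ?addr0.
rewrite [w * 1]mulr1 [in sin w]/w sin_2piz mulr0 sub0r.
suff -> : (clamp a - a) * sin (w * clamp a) = 0.
  by rewrite oppr0 => /eqP; rewrite addr_eq0 => /eqP.
case: (clampP a) => [[? ->]|[? [? ->]]|[? ->]].
- by rewrite mulr0 sin0 mulr0.
- by rewrite subrr mul0r.
- by rewrite mulr1 sin_2piz mulr0.
Qed.

(** Here the cosine is 1 at the endpoints, so a boundary term survives. It is written as the
    increment of the hinge over [[0, 1]], so that it cancels in a combination of hinges with equal
    end values. *)
Lemma I01_hinge_sin (q : int) a : let w := 2 * pi * q%:~R in
  w * I01 (fun x => hinge a x * sin (w * x)) =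
  I01 (cutoff a (fun x => cos (w * x))) - (hinge a 1 - hinge a 0).
Proof.
move=> w; set f := fun x => w * ((x - a) * sin (w * x)) - cos (w * x).
have cf : continuous f.
  move=> x; apply: cvgB; last exact: continuous_cosM.
  apply: cvgM; first exact: cvg_cst.
  by apply: cvgM; [exact: continuous_subC|exact: continuous_sinM].
have dF x : is_derive x 1 (fun y => (a - y) * cos (w * y)) (f x).
  have h1 : is_derive x (1 : R) (fun y => a - y) (-1).
    by apply: is_derive_eq => /=; ring.
  have h2 := is_derive_cosM w x.
  by apply: is_derive_eq; rewrite /f /GRing.scale /=; ring.
have := I01_cutoff a f _ cf dF.
have -> : I01 (cutoff a f) = w * I01 (fun x => hinge a x * sin (w * x)) -
    I01 (cutoff a (fun x => cos (w * x))).
  have h1 : bmeas (fun x => hinge a x * sin (w * x)).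
    apply: bmeasM (bmeas_hinge _) _; exact: bmeas_continuous _ (continuous_sinM _).
  have h2 : bmeas (cutoff a (fun x => cos (w * x))).
    exact: bmeas_cutoff _ _ (bmeas_continuous _ (continuous_cosM _)).
  rewrite -I01Z // -I01B //; last exact: bmeasZ.
  apply: eq_I01 => x _; rewrite hingeE /cutoff /f.
  by case: ifP; rewrite ?mul0r ?mulr0 ?subr0.
rewrite mulr1 {3}/w cos_2piz hinge_clamp => /eqP; rewrite subr_eq => /eqP ->.
suff -> : (a - clamp a) * cos (w * clamp a) = a - clamp a by ring.
case: (clampP a) => [[? ->]|[? [? ->]]|[? ->]].
- by rewrite mulr0 cos0 mulr1.
- by rewrite subrr mul0r.
- by rewrite mulr1 cos_2piz mulr1.
Qed.

(** Once [w] is moved inside, the integrand has the primitive [sin (w * x)], and a difference of two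
    sines is at most 2. *)
Lemma I01_cutoff_cos w a : `|w * I01 (cutoff a (fun x => cos (w * x)))| <= 2.
Proof.
rewrite -I01Z; last exact: bmeas_cutoff _ _ (bmeas_continuous _ (continuous_cosM _)).
rewrite (eq_I01 _ (cutoff a (fun x => w * cos (w * x)))); last first.
  by move=> x _; rewrite /cutoff; case: ifP; rewrite ?mulr0.
have cf : continuous (fun x => w * cos (w * x)).
  by move=> x; apply: cvgM; [exact: cvg_cst|exact: continuous_cosM].
rewrite (I01_cutoff a _ _ cf (is_derive_sinM w)).
apply: le_trans (ler_normB _ _) _; rewrite [leRHS](_ : _ = 1 + 1 :> R) //.
by apply: lerD; rewrite ler_norml sin_geN1 sin_le1.
Qed.

Lemma I01_cutoff_sin w a : `|w * I01 (cutoff a (fun x => sin (w * x)))| <= 2.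
Proof.
rewrite -normrN -mulNr.
rewrite -I01Z; last exact: bmeas_cutoff _ _ (bmeas_continuous _ (continuous_sinM _)).
rewrite (eq_I01 _ (cutoff a (fun x => - (w * sin (w * x))))); last first.
  by move=> x _; rewrite /cutoff; case: ifP; rewrite ?mulr0 ?mulNr.
have cf : continuous (fun x => - (w * sin (w * x))).
  move=> x; apply: cvgN; apply: cvgM; [exact: cvg_cst|exact: continuous_sinM].
rewrite (I01_cutoff a _ _ cf (is_derive_cosM w)).
apply: le_trans (ler_normB _ _) _; rewrite [leRHS](_ : _ = 1 + 1 :> R) //.
by apply: lerD; rewrite ler_norml cos_geN1 cos_le1.
Qed.

(** A pair in [s] is a slope jump followed by its breakpoint; [hstep] is the derivative of [hsum]
    away from the breakpoints. *)
Definition hsum s x : R := \sum_(p <- s) p.1 * hinge p.2 x.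
Definition hstep s x : R := \sum_(p <- s) p.1 * cutoff p.2 (fun=> 1) x.

Lemma bmeas_hsum s : bmeas (hsum s).
Proof. by apply: bmeas_sum => p; apply: bmeasZ; exact: bmeas_hinge. Qed.

Lemma bmeas_hstep s : bmeas (hstep s).
Proof. by apply: bmeas_sum => p; apply: bmeasZ; apply: bmeas_cutoff; exact: bmeas_cst. Qed.

Lemma I01_hsumM s g : bmeas g ->
  I01 (fun x => hsum s x * g x) =
  \sum_(p <- s) p.1 * I01 (fun x => hinge p.2 x * g x).
Proof.
move=> hg; rewrite (eq_I01 _ (fun x => \sum_(p <- s) p.1 * (hinge p.2 x * g x))).
  rewrite I01_sum => [|p].
    by apply: eq_bigr => p _; rewrite I01Z //; exact: bmeasM (bmeas_hinge _) hg.
  by apply: bmeasZ; exact: bmeasM (bmeas_hinge _) hg.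
by move=> x _; rewrite mulr_suml; apply: eq_bigr => p _; rewrite mulrA.
Qed.

Lemma I01_hstepM s g : bmeas g ->
  I01 (fun x => hstep s x * g x) = \sum_(p <- s) p.1 * I01 (cutoff p.2 g).
Proof.
move=> hg; rewrite (eq_I01 _ (fun x => \sum_(p <- s) p.1 * cutoff p.2 g x)).
  rewrite I01_sum => [|p].
    by apply: eq_bigr => p _; rewrite I01Z //; exact: bmeas_cutoff.
  by apply: bmeasZ; exact: bmeas_cutoff.
move=> x _; rewrite mulr_suml; apply: eq_bigr => p _.
by rewrite -mulrA /cutoff; case: ifP; rewrite ?mul1r ?mul0r.
Qed.

Lemma I01_hstep_sin s (q : int) : let w := 2 * pi * q%:~R in
  I01 (fun x => hstep s x * sin (w * x)) =
  - (w * I01 (fun x => hsum s x * cos (w * x))).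
Proof.
move=> w; rewrite I01_hstepM ?I01_hsumM; try exact: bmeas_continuous _ (continuous_sinM _);
  try exact: bmeas_continuous _ (continuous_cosM _).
rewrite mulr_sumr -sumrN; apply: eq_bigr => p _.
by rewrite mulrCA (I01_hinge_cos q) mulrN opprK.
Qed.

(** The boundary terms of [I01_hinge_sin] add up to [hsum s 1 - hsum s 0]; this is where periodicity
    enters. *)
Lemma I01_hstep_cos s (q : int) : hsum s 0 = hsum s 1 ->
  let w := 2 * pi * q%:~R in
  I01 (fun x => hstep s x * cos (w * x)) =
  w * I01 (fun x => hsum s x * sin (w * x)).
Proof.
move=> s01 w; rewrite I01_hstepM ?I01_hsumM; try exact: bmeas_continuous _ (continuous_sinM _);
  try exact: bmeas_continuous _ (continuous_cosM _).
rewrite mulr_sumr [RHS](eq_bigr (fun p => p.1 * I01 (cutoff p.2 (fun x => cos (w * x)))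
   - (p.1 * hinge p.2 1 - p.1 * hinge p.2 0))).
  by rewrite !sumrB -/(hsum s 1) -/(hsum s 0) s01 subrr subr0.
by move=> p _; rewrite mulrCA (I01_hinge_sin q) !mulrBr.
Qed.

(** Each factor [w] pays for one integration by parts: the first turns hinges into steps, the second
    bounds the integral of each step against a sine by 2. *)
Lemma I01_hsum_cos_le s (q : int) w : w = 2 * pi * q%:~R ->
  w ^+ 2 * `|I01 (fun x => hsum s x * cos (w * x))| <= 2 * \sum_(p <- s) `|p.1|.
Proof.
move=> -> {w}; set w := 2 * pi * _; set X := I01 _.
have -> : w ^+ 2 * `|X| = `|w * (- (w * X))|.
  by rewrite mulrN normrN mulrA normrM -expr2 (ger0_norm (sqr_ge0 w)).
rewrite -(I01_hstep_sin s q) I01_hstepM; last exact: bmeas_continuous _ (continuous_sinM _).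
rewrite !mulr_sumr; apply: le_trans (ler_norm_sum _ _ _) _.
apply: ler_sum => p _; rewrite mulrCA normrM mulrC.
by apply: ler_wpM2r => //; exact: I01_cutoff_sin.
Qed.

Lemma I01_hsum_sin_le s (q : int) w : hsum s 0 = hsum s 1 ->
  w = 2 * pi * q%:~R ->
  w ^+ 2 * `|I01 (fun x => hsum s x * sin (w * x))| <= 2 * \sum_(p <- s) `|p.1|.
Proof.
move=> s01 -> {w}; set w := 2 * pi * _; set X := I01 _.
have -> : w ^+ 2 * `|X| = `|w * (w * X)|.
  by rewrite mulrA normrM -expr2 (ger0_norm (sqr_ge0 w)).
rewrite -(I01_hstep_cos s q s01) I01_hstepM; last exact: bmeas_continuous _ (continuous_cosM _).
rewrite !mulr_sumr; apply: le_trans (ler_norm_sum _ _ _) _.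
apply: ler_sum => p _; rewrite mulrCA normrM mulrC.
by apply: ler_wpM2r => //; exact: I01_cutoff_cos.
Qed.

Lemma is_derive_hinge a x : x != a ->
  is_derive x 1 (hinge a) (cutoff a (fun=> 1) x).
Proof.
move=> xa; rewrite /cutoff; case: ifPn => ax.
  have h : is_derive x (1 : R) (fun y => y - a) 1.
    by apply: is_derive_eq; rewrite subr0.
  apply: near_eq_is_derive h; near=> y.
  rewrite hingeE /cutoff ifT //; near: y; exact: lt_nbhsr.
have xa' : x < a by rewrite lt_neqAle xa leNgt.
have h : is_derive x (1 : R) (fun=> 0 : R) 0 by exact: is_derive_cst.
apply: near_eq_is_derive h; near=> y.
rewrite hingeE /cutoff ifF //; apply/negbTE; rewrite -leNgt ltW //.
near: y; exact: lt_nbhsl.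
Unshelve. all: by end_near.
Qed.

Lemma derive1_hsum f s x : 0 < x < 1 -> x \notin map snd s ->
  (forall y, 0 < y < 1 -> f y = hsum s y) -> derive1 f x = hstep s x.
Proof.
move=> /andP[x0 x1] xs fs.
rewrite derive1E (near_eq_derive (g := hsum s)); last first.
  near=> y; apply: fs; apply/andP; split; near: y.
    exact: lt_nbhsr.
  exact: lt_nbhsl.
have h : is_derive x (1 : R) (hsum s) (hstep s x).
  elim: s xs {fs} => [|p s IH] xs.
    have -> : hsum [::] = (fun=> 0).
      by apply/funext => y; rewrite /hsum big_nil.
    by rewrite /hstep big_nil; exact: is_derive_cst.
  move: xs; rewrite /= inE negb_or => /andP[xp /IH{}IH].
  have -> : hsum (p :: s) = (fun y => p.1 * hinge p.2 y + hsum s y).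
    by apply/funext => y; rewrite /hsum big_cons.
  rewrite /hstep big_cons -/(hstep s x).
  have h1 := is_derive_hinge _ _ xp.
  by apply: is_derive_eq; rewrite /GRing.scale /= ?mulr0 ?addr0; ring.
by have [_ ->] := h.
Unshelve. all: by end_near.
Qed.

End Hinges.

(** * Hinge representation of the periodized wavelets *)

Section Wavelets.
Context {R : realType}.
Implicit Types (f g F : R -> R) (a b x w M K : R) (s : seq (R * R)).

Lemma phi_hinge x : phi x = hinge (-1) x - 2 * hinge 0 x + hinge 1 x.
Proof.
rewrite /phi /hinge opprK subr0.
case: (leP 0 x) => x0; rewrite ?(ger0_norm x0) ?(ltr0_norm x0) ?opprK.
  by case: (leP 0 (1 - x)); case: (leP 0 (x + 1)); case: (leP 0 (x - 1)); lra.
by case: (leP 0 (1 + x)); case: (leP 0 (x + 1)); case: (leP 0 (x - 1)); lra.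
Qed.

Lemma phi_ge0 x : 0 <= phi x.
Proof. by rewrite /phi le_max lexx. Qed.

Lemma phi_eq0 x : 1 <= `|x| -> phi x = 0.
Proof. by move=> h; rewrite /phi max_l // subr_le0. Qed.

Lemma phi_le1 x : phi x <= 1.
Proof. by rewrite /phi ge_max ler01 /= gerBl. Qed.

Lemma hinge_scale M c x a : 0 < M -> hinge c (M * x - a) = M * hinge ((a + c) / M) x.
Proof.
move=> M0; rewrite /hinge maxr_pMr ?ltW // mulr0; congr Num.max.
by field; exact: lt0r_neq0.
Qed.

Lemma I01_cutoff1 a : I01 (cutoff a (fun=> 1)) = 1 - clamp a.
Proof.
have c1 : continuous (fun _ : R => 1 : R) by exact: cst_continuous.
have d1 x : is_derive x (1 : R) id (1 : R) by exact: is_derive_id.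
by have := I01_cutoff a (fun=> 1) id c1 d1.
Qed.

Lemma clamp_sub a b : a <= b -> clamp b - clamp a <= b - a.
Proof.
move=> ab; case: (clampP a) => [[? ->]|[? [? ->]]|[? ->]];
  by case: (clampP b) => [[? ->]|[? [? ->]]|[? ->]]; lra.
Qed.

(** [W] controls the decay in frequency and [B] the size of the integral. They are tracked
    separately because the cancellation between hinges that makes a bump small in mean is invisible
    in the weights. The equality with [hsum] holds on the whole line, hence also at the endpoints 0
    and 1. *)
Definition hrep f (W B : R) : Prop := exists s,
  [/\ forall x, f x = hsum s x, \sum_(p <- s) `|p.1| <= W
    & I01 (fun x => `|f x|) <= B].

Lemma bmeas_norm f : bmeas f -> bmeas (fun x => `|f x|).
Proof.
move=> [mf [M hM]]; split; first exact: measurableT_comp.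
by exists M => x hx; rewrite normr_id hM.
Qed.

Lemma hrep_bmeas f W B : hrep f W B -> bmeas f.
Proof. by move=> [s [fs _ _]]; apply: eq_bmeas (bmeas_hsum s) => x _; rewrite fs. Qed.

Lemma hrepD f g W B W' B' : hrep f W B -> hrep g W' B' ->
  hrep (fun x => f x + g x) (W + W') (B + B').
Proof.
move=> hf hg; have mf := hrep_bmeas _ _ _ hf; have mg := hrep_bmeas _ _ _ hg.
have [s [fs Ws Bs]] := hf; have [t [gt Wt Bt]] := hg.
exists (s ++ t); split.
- by move=> x; rewrite /hsum big_cat fs gt.
- by rewrite big_cat lerD.
- apply: le_trans (lerD Bs Bt); rewrite -I01D; try exact: bmeas_norm.
  apply: le_I01; [exact/bmeas_norm/bmeasD| |by move=> x _; exact: ler_normD].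
  by apply: bmeasD; exact: bmeas_norm.
Qed.

Lemma hrepZ (c : R) f W B : hrep f W B ->
  hrep (fun x => c * f x) (`|c| * W) (`|c| * B).
Proof.
move=> hf; have mf := hrep_bmeas _ _ _ hf; have [s [fs Ws Bs]] := hf.
exists [seq (c * p.1, p.2) | p <- s]; split.
- move=> x; rewrite /hsum big_map fs mulr_sumr.
  by apply: eq_bigr => p _; rewrite mulrA.
- rewrite big_map /=.
  rewrite (eq_bigr (fun p => `|c| * `|p.1|)); last by move=> p _; rewrite normrM.
  by rewrite -mulr_sumr ler_wpM2l.
- rewrite (eq_I01 _ (fun x => `|c| * `|f x|)); last by move=> x _; rewrite normrM.
  by rewrite I01Z ?ler_wpM2l //; exact: bmeas_norm.
Qed.

(** The slope jumps are [M], [-2M], [M], and the bump has height 1 and support of length [2 / M]. *)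
Lemma hrep_bump M K : 0 < M -> hrep (fun x => phi (M * x - K)) (4 * M) (2 / M).
Proof.
move=> M0; have Mn0 : M != 0 by exact: lt0r_neq0.
have fs x : phi (M * x - K) =
    hsum [:: (M, (K - 1) / M); (- (2 * M), K / M); (M, (K + 1) / M)] x.
  rewrite phi_hinge !hinge_scale // addr0 /hsum !big_cons big_nil /=; ring.
have mf : bmeas (fun x => phi (M * x - K)).
  by apply: eq_bmeas (bmeas_hsum _) => x _; rewrite fs.
eexists; split; first exact: fs.
  rewrite !big_cons big_nil /= normrN normrM !(ger0_norm (ltW M0)) ger0_norm //; lra.
set a := (K - 1) / M; set b := (K + 1) / M.
have ab : b - a = 2 / M by rewrite /a /b; field.
have hc c : bmeas (cutoff c (fun=> 1 : R)) by apply: bmeas_cutoff; exact: bmeas_cst.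
(* The majorant is the indicator of the support, written as a difference of two steps; its integral
   is [clamp b - clamp a]. *)
have := @le_I01 R (fun x => `|phi (M * x - K)|)
  (fun x => cutoff a (fun=> 1) x - cutoff b (fun=> 1) x).
rewrite I01B // !I01_cutoff1 => h; apply: le_trans (h _ _ _) _.
- exact: bmeas_norm.
- exact: bmeasB.
- move=> x _; rewrite ger0_norm ?phi_ge0 // /cutoff.
  have [ax|xa] := ltP a x; have [bx|xb] := ltP b x.
  + rewrite phi_eq0 ?subrr //; apply: le_trans (ler_norm _).
    by move: bx; rewrite /b ltr_pdivrMr //; lra.
  + by rewrite subr0 phi_le1.
  + have : b < a by exact: lt_le_trans xa.
    by rewrite -subr_gt0 -opprB ab oppr_gt0 pmulr_llt0 ?invr_gt0 //; lra.
  + rewrite phi_eq0 ?subrr // -normrN; apply: le_trans (ler_norm _).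
    by move: xa; rewrite /a ler_pdivlMr //; lra.
- rewrite -ab (_ : _ - _ = clamp b - clamp a); last by ring.
  apply: clamp_sub; rewrite -subr_ge0 ab divr_ge0 // ltW //.
Qed.

(* The translates of the bump that can meet [(0, 1)]. *)
Definition bump4 M K x : R := phi (M * x - K) + phi (M * (x - 1) - K)
  + phi (M * (x + 1) - K) + phi (M * (x - 2) - K).

Lemma hrep_bump4 M K : 0 < M -> hrep (bump4 M K) (16 * M) (8 / M).
Proof.
move=> M0.
have h := hrepD _ _ _ _ _ _ (hrepD _ _ _ _ _ _ (hrepD _ _ _ _ _ _ (hrep_bump _ K M0)
  (hrep_bump _ (K + M) M0)) (hrep_bump _ (K - M) M0)) (hrep_bump _ (K + 2 * M) M0).
have -> : 16 * M = 4 * M + 4 * M + 4 * M + 4 * M by ring.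
have -> : 8 / M = 2 / M + 2 / M + 2 / M + 2 / M by field; exact: lt0r_neq0.
suff -> : bump4 M K = (fun x : R => phi (M * x - K) + phi (M * x - (K + M)) +
  phi (M * x - (K - M)) + phi (M * x - (K + 2 * M))) by exact: h.
by apply/funext => x; rewrite /bump4; congr (phi _ + phi _ + phi _ + phi _); ring.
Qed.

(** The translates at 0 and at 1 share three arguments of [phi]. The two left over, [-2M - K] and
    [2M - K], have modulus at least 1 by the bounds on [K]. *)
Lemma bump4_periodic M K : 1 - 2 * M <= K <= 2 * M - 1 ->
  bump4 M K 0 = bump4 M K 1.
Proof.
move=> /andP[K1 K2]; rewrite /bump4.
rewrite (phi_eq0 (M * (0 - 2) - K)); last first.
  by rewrite -normrN; apply: le_trans (ler_norm _); lra.
rewrite (phi_eq0 (M * (1 + 1) - K)); last by apply: le_trans (ler_norm _); lra.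
have -> : M * 0 - K = M * (1 - 1) - K by ring.
have -> : M * (0 - 1) - K = M * (1 - 2) - K by ring.
have -> : M * (0 + 1) - K = M * 1 - K by ring.
by ring.
Qed.

Lemma per_support2 f x : (forall y, 2 <= `|y| -> f y = 0) -> 0 < x < 1 ->
  per f x = f x + f (x - 1) + f (x + 1) + f (x - 2).
Proof.
move=> f0 /andP[x0 x1]; rewrite /per; apply: norm_lim_near_cst.
(* From two terms on the symmetric partial sums are constant: every further argument is at least 2
   or at most -2. *)
exists 2%N => // -[|[|N]] //= _.
rewrite big_nat_recl // big_nat_recl //= big1 => [|i _].
  by rewrite !addr0 !addrA.
rewrite !f0 ?addr0 //.
  rewrite -normrN; apply: le_trans (ler_norm _).
  have : (0 : R) <= i%:R by []; rewrite -!natr1; lra.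
apply: le_trans (ler_norm _).
have : (0 : R) <= i%:R by []; rewrite -!natr1; lra.
Qed.

(** The constants come from the wavelet case: the mask has absolute sum 3 and its bumps live at
    scale [2 * M], which gives [3 * 16 * 2 = 96] and [3 * 8 / 2 = 12]. The scaling function needs
    only 16 and 8. *)
Lemma theta_hrep l (k : int) (e : bool) : (2 <= l)%N -> 0 <= k -> k < (2 ^ l)%:Z ->
  exists f : R -> R, [/\ forall x, 0 < x < 1 -> theta l k e x = f x, f 0 = f 1
    & hrep f (96 * (Num.sqrt (2 ^+ l) * 2 ^+ l)) (12 * (Num.sqrt (2 ^+ l) / 2 ^+ l))].
Proof.
move=> l2 k0 k1.
set S := Num.sqrt _; set M : R := 2 ^+ l; set K : R := k%:~R.
have M4 : 4 <= M.
  rewrite /M -(subnK l2) exprD; have : (1 : R) <= 2 ^+ (l - 2).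
    by apply: exprn_ege1; lra.
  by move=> ?; rewrite expr2; lra.
have M0 : 0 < M by lra.
have Mn0 : M != 0 by exact: lt0r_neq0.
have S0 : 0 <= S by exact: sqrtr_ge0.
have K0 : 0 <= K by rewrite /K ler0z.
have K1 : K <= M - 1.
  have : k + 1 <= (2 ^ l)%:Z by rewrite lezD1.
  rewrite -(ler_int R) rmorphD /= -pmulrn natrX => ?.
  by rewrite /K /M; lra.
have SM0 : 0 <= S * M by rewrite mulr_ge0 // ltW.
have SV0 : 0 <= S / M by rewrite divr_ge0 // ltW.
have hrep_le f W B W' B' : hrep f W B -> W <= W' -> B <= B' -> hrep f W' B'.
  by move=> [s [? W1 B1]] W2 B2; exists s; split => //;
    [exact: le_trans W1 W2|exact: le_trans B1 B2].
rewrite /theta; case: e; last first.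
  exists (fun x => S * bump4 M K x); split.
  - move=> x hx; rewrite per_support2 // => [|y y2].
      by rewrite /phi_lk -/S -/M -/K /bump4; ring.
    rewrite /phi_lk phi_eq0 ?mulr0 // -/M -/K.
    have [yp|yn] := leP 0 y.
      apply: le_trans (ler_norm _); move: y2; rewrite ger0_norm //; nra.
    rewrite -normrN; apply: le_trans (ler_norm _); move: y2; rewrite ltr0_norm //; nra.
  - by rewrite bump4_periodic //; apply/andP; split; lra.
  - apply: (hrep_le _ _ _ _ _ (hrepZ S _ _ _ (hrep_bump4 _ K M0))).
      by rewrite ger0_norm // mulrCA; lra.
    by rewrite ger0_norm // mulrCA; lra.
have M20 : 0 < 2 * M by lra.
(* The argument [2 * (M * x - K) - j] is that of a bump at scale [2 * M] with shift [2 * K + j], for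
   [j] from -1 to 3. *)
exists (fun x => S * (4^-1 * bump4 (2 * M) (2 * K - 1) x
   + 2^-1 * bump4 (2 * M) (2 * K) x + (- (3 / 2)) * bump4 (2 * M) (2 * K + 1) x
   + 2^-1 * bump4 (2 * M) (2 * K + 2) x + 4^-1 * bump4 (2 * M) (2 * K + 3) x)); split.
- move=> x hx; rewrite per_support2 // => [|y y2].
    rewrite /psi_lk -/S -/M -/K /bump4 /psi.
    have E c j : phi (2 * M * c - (2 * K + j)) = phi (2 * (M * c - K) - j).
      by congr phi; ring.
    have E0 c : phi (2 * M * c - 2 * K) = phi (2 * (M * c - K)) by congr phi; ring.
    have E1 c : phi (2 * M * c - (2 * K - 1)) = phi (2 * (M * c - K) + 1) by congr phi; ring.
    by rewrite !E1 !E !E0; ring.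
  set z := 2 * (M * y - K).
  have H c j : c = z - j -> -1 <= j -> j <= 3 -> phi c = 0.
    move=> -> j1 j2; apply: phi_eq0; rewrite /z; have [yp|yn] := leP 0 y.
      apply: le_trans (ler_norm _); move: y2; rewrite ger0_norm //; nra.
    rewrite -normrN; apply: le_trans (ler_norm _); move: y2; rewrite ltr0_norm //; nra.
  rewrite /psi_lk -/M -/K /psi -/z (H (z + 1) (-1)) ?(H z 0) ?(H (z - 1) 1)
    ?(H (z - 2) 2) ?(H (z - 3) 3) //; try lra; by ring.
- by rewrite !bump4_periodic //; apply/andP; split; lra.
- have h := hrepZ S _ _ _ (hrepD _ _ _ _ _ _ (hrepD _ _ _ _ _ _ (hrepD _ _ _ _ _ _
    (hrepD _ _ _ _ _ _ (hrepZ 4^-1 _ _ _ (hrep_bump4 _ (2 * K - 1) M20))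
     (hrepZ 2^-1 _ _ _ (hrep_bump4 _ (2 * K) M20)))
     (hrepZ (- (3 / 2)) _ _ _ (hrep_bump4 _ (2 * K + 1) M20)))
     (hrepZ 2^-1 _ _ _ (hrep_bump4 _ (2 * K + 2) M20)))
     (hrepZ 4^-1 _ _ _ (hrep_bump4 _ (2 * K + 3) M20))).
  apply: (hrep_le _ _ _ _ _ h).
    by rewrite normrN !ger0_norm //; lra.
  by rewrite normrN !ger0_norm //; lra.
Qed.

End Wavelets.

(** * Separable integrands *)

Section ComplexIntegral.
Context {R : realType}.
Implicit Types (g h : R -> R[i]).

Definition I01c g : R[i] :=
  (I01 (fun x => complex.Re (g x)) +i* I01 (fun x => complex.Im (g x)))%C.

Definition bmeasc g : Prop :=
  bmeas (fun x => complex.Re (g x)) /\ bmeas (fun x => complex.Im (g x)).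

Lemma complex_ReM (a b : R[i]) :
  complex.Re (a * b) = complex.Re a * complex.Re b - complex.Im a * complex.Im b.
Proof. by case: a => ? ?; case: b. Qed.

Lemma complex_ImM (a b : R[i]) :
  complex.Im (a * b) = complex.Re a * complex.Im b + complex.Im a * complex.Re b.
Proof. by case: a => ? ?; case: b. Qed.

Lemma bmeascM g h : bmeasc g -> bmeasc h -> bmeasc (fun x => g x * h x).
Proof.
move=> [g1 g2] [h1 h2]; split.
  apply: (@eq_bmeas _ (fun x => complex.Re (g x) * complex.Re (h x)
    - complex.Im (g x) * complex.Im (h x))); first by move=> x _; rewrite complex_ReM.
  by apply: bmeasB; exact: bmeasM.
apply: (@eq_bmeas _ (fun x => complex.Re (g x) * complex.Im (h x)
  + complex.Im (g x) * complex.Re (h x))); first by move=> x _; rewrite complex_ImM.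
by apply: bmeasD; exact: bmeasM.
Qed.

Lemma bmeasc_real (f : R -> R) : bmeas f -> bmeasc (fun x => (f x)%:C).
Proof. by move=> hf; split => //; exact: bmeas_cst. Qed.

Lemma I01c_sum (T : Type) (s : seq T) (a : T -> R[i]) (g : T -> R -> R[i]) :
  (forall t, bmeasc (g t)) ->
  I01c (fun x => \sum_(t <- s) a t * g t x) = \sum_(t <- s) a t * I01c (g t).
Proof.
move=> hg.
have hR t : bmeas (fun x => complex.Re (g t x)) by have [] := hg t.
have hI t : bmeas (fun x => complex.Im (g t x)) by have [] := hg t.
apply/eqP; rewrite eq_complex; apply/andP; split; apply/eqP => /=.
- rewrite (eq_I01 _ (fun x => \sum_(t <- s) (complex.Re (a t) * complex.Re (g t x)
    - complex.Im (a t) * complex.Im (g t x)))).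
    rewrite I01_sum => [|t]; last by apply: bmeasB; exact: bmeasZ.
    rewrite raddf_sum; apply: eq_bigr => t _; rewrite [RHS]complex_ReM /= I01B; try exact: bmeasZ.
    by rewrite !I01Z.
  by move=> x _; rewrite raddf_sum; apply: eq_bigr => t _; exact: complex_ReM.
- rewrite (eq_I01 _ (fun x => \sum_(t <- s) (complex.Re (a t) * complex.Im (g t x)
    + complex.Im (a t) * complex.Re (g t x)))).
    rewrite I01_sum => [|t]; last by apply: bmeasD; exact: bmeasZ.
    rewrite raddf_sum; apply: eq_bigr => t _; rewrite [RHS]complex_ImM /= I01D; try exact: bmeasZ.
    by rewrite !I01Z.
  by move=> x _; rewrite raddf_sum; apply: eq_bigr => t _; exact: complex_ImM.
Qed.

(** For a fixed value of the outermost coordinate its factor is a scalar and joins the coefficient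
    [a t]; hence the induction runs over all [a]. Both parts are treated together since complex
    multiplication mixes them. *)
Lemma iint_separable (T : Type) (s : seq T) (m : nat) (g : T -> nat -> R -> R[i]) :
  (forall t j, bmeasc (g t j)) -> forall a : T -> R[i],
  (iint m (fun y => complex.Re (\sum_(t <- s) a t * \prod_(j < m) g t j (y j))) +i*
   iint m (fun y => complex.Im (\sum_(t <- s) a t * \prod_(j < m) g t j (y j))))%C
  = \sum_(t <- s) a t * \prod_(j < m) I01c (g t j).
Proof.
move=> hg; elim: m => [|m IH] a /=.
  under eq_bigr do rewrite big_ord0.
  under [RHS]eq_bigr do rewrite big_ord0.
  by case: (\sum_(t <- s) _).
have E x (y : nat -> R) :
    \sum_(t <- s) a t * \prod_(j < m.+1) g t j (if j == m :> nat then x else y j) =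
    \sum_(t <- s) (a t * g t m x) * \prod_(j < m) g t j (y j).
  apply: eq_bigr => t _; rewrite big_ord_recr /= eqxx -mulrA; congr (_ * _).
  rewrite mulrC; congr (_ * _); apply: eq_bigr => j _.
  by rewrite ltn_eqF.
rewrite -[RHS](_ : I01c (fun x => \sum_(t <- s)
  (a t * \prod_(j < m) I01c (g t j)) * g t m x) = _); last first.
  rewrite I01c_sum //; apply: eq_bigr => t _.
  by rewrite big_ord_recr /= mulrA.
have E2 x : \sum_(t <- s) (a t * \prod_(j < m) I01c (g t j)) * g t m x =
    \sum_(t <- s) (a t * g t m x) * \prod_(j < m) I01c (g t j).
  by apply: eq_bigr => t _; rewrite mulrAC.
congr (_ +i* _)%C; apply: eq_Rintegral => x _.
  by rewrite E2 -IH /=; congr iint; apply/funext => y; rewrite E.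
by rewrite E2 -IH /=; congr iint; apply/funext => y; rewrite E.
Qed.

Lemma cintD_separable (T : Type) (s : seq T) (n : nat) (a : T -> R[i])
    (g : T -> 'I_n -> R -> R[i]) (F : ('I_n -> R) -> R[i]) :
  (forall t j, bmeasc (g t j)) ->
  (forall x, F x = \sum_(t <- s) a t * \prod_(j < n) g t j (x j)) ->
  cintD F = \sum_(t <- s) a t * \prod_(j < n) I01c (g t j).
Proof.
move=> hg hF.
(* [iint] numbers coordinates by naturals, so the family is extended by zero beyond [n]. *)
pose G t (j : nat) : R -> R[i] := if insub j is Some i then g t i else fun=> 0.
have GE t (j : 'I_n) : G t j = g t j by rewrite /G valK.
have hG t j : bmeasc (G t j).
  by rewrite /G; case: insub => // ; split; exact: bmeas_cst.
have := iint_separable _ s n _ hG a.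
under [in X in _ = X -> _]eq_bigr do under eq_bigr do rewrite GE.
move=> <-; rewrite /cintD /intD; congr (_ +i* _)%C; congr iint; apply/funext => y;
  by rewrite hF; congr (_ _); apply: eq_bigr => t _; congr (_ * _);
     apply: eq_bigr => j _; rewrite GE.
Qed.

(** The conjugate character [exp(-2 pi i q x)], since the form conjugates its second argument. *)
Definition expi (q : int) (x : R) : R[i] :=
  (cos (2 * pi * q%:~R * x) +i* - sin (2 * pi * q%:~R * x))%C.

Lemma bmeasc_expi q : bmeasc (expi q).
Proof.
split; first exact: bmeas_continuous _ (continuous_cosM _).
exact: bmeasN _ (bmeas_continuous _ (continuous_sinM _)).
Qed.

Lemma expi_prod n (q : 'I_n -> int) (x : 'I_n -> R) :
  conjc (xi q x) = \prod_(j < n) expi (q j) (x j).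
Proof.
rewrite /xi mulr_sumr.
rewrite (eq_bigr (fun i => 2 * pi * (q i)%:~R * x i)); last by move=> i _; rewrite mulrA.
elim/big_rec2: _ => [|i z y _ /= <-].
  by rewrite /= cos0 sin0 oppr0.
rewrite /expi /= cosD sinD; apply/eqP; rewrite eq_complex /=.
by apply/andP; split; apply/eqP; ring.
Qed.

(* Unconditional, since [lim] is [0] when the difference quotient diverges. *)
Lemma derive1Zl (c : R) (f : R -> R) x :
  derive1 (fun t => c * f t) x = c * derive1 f x.
Proof.
have [->|c0] := eqVneq c 0.
  rewrite mul0r (_ : (fun t => _) = cst 0) ?derive1_cst //.
  by apply/funext => t; rewrite mul0r.
have [df|ndf] := pselect (derivable f x 1).
  by rewrite !derive1E -[RHS]deriveZ.
have nd : ~ derivable (fun t => c * f t) x 1.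
  move=> d; apply: ndf.
  have -> : f = c^-1 \*: (fun t => c * f t).
    by apply/funext => t; rewrite /= /GRing.scale /= mulKf.
  exact: derivableZ.
by rewrite !derive1E /derive (dvgP nd) (dvgP ndf) [X in c * X](_ : _ = 0 :> R) // mulr0.
Qed.

(** Along coordinate [i] all other factors are constants, and [derive1Zl] extracts them even at the
    kinks of [theta], so the identity holds at every point. *)
Lemma pd_psi_iso_hat n l (k : 'I_n -> int) (e : 'I_n -> bool) (i : 'I_n) (x : 'I_n -> R) :
  pd i (psi_iso_hat l k e) x =
  ((2 ^+ l)^-1 * \prod_(j < n) (if j == i then derive1 (theta l (k j) (e j)) (x j)
     else theta l (k j) (e j) (x j)))%:C.
Proof.
rewrite /pd /psi_iso_hat /=.
rewrite [X in (_ +i* X)%C](_ : _ = 0); last exact: derive1_cst.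
congr (_ +i* _)%C.
rewrite (_ : (fun t => _) = (fun t => ((2 ^+ l)^-1 *
   \prod_(j < n | j != i) theta l (k j) (e j) (x j)) * theta l (k i) (e i) t)).
  rewrite derive1Zl -mulrA [in RHS](bigD1 i) //= eqxx; congr (_ * _).
  rewrite mulrC; congr (_ * _).
  by apply: eq_bigr => j /negPf ->.
apply/funext => t; rewrite /psi_iso (bigD1 i) //= /upd eqxx -mulrA; congr (_ * _).
rewrite mulrC; congr (_ * _).
by apply: eq_bigr => j /negPf ->.
Qed.

Lemma pd_xi_hat n (q : 'I_n -> int) (i : 'I_n) (x : 'I_n -> R) :
  pd i (xi_hat q) x = (0 +i* (2 * pi * (q i)%:~R))%C * xi_hat q x.
Proof.
rewrite /pd /xi_hat /xi; set nu := (Num.sqrt _)^-1.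
set w : R := 2 * pi * (q i)%:~R.
set r := \sum_(j < n | j != i) 2 * pi * ((q j)%:~R * x j).
have Er t : 2 * pi * (\sum_(j < n) (q j)%:~R * upd x i t j) = w * t + r.
  rewrite mulr_sumr (bigD1 i) //= /upd eqxx mulrA; congr (_ + _).
  by apply: eq_bigr => j /negPf ->.
have Ex : 2 * pi * (\sum_(j < n) (q j)%:~R * x j) = w * x i + r.
  rewrite -Er; congr (_ * _); apply: eq_bigr => j _; congr (_ * _).
  by rewrite /upd; case: eqP => // ->.
rewrite Ex.
have h : is_derive (x i) (1 : R) (fun y => w * y + r) w.
  by apply: is_derive_eq; rewrite ?addr0 [LHS]mulr1.
have hc : is_derive (x i) (1 : R) (fun t => nu * cos (w * t + r)) (nu * (- (w * sin (w * x i + r)))).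
  have := @is_derive1_comp R cos (fun y => w * y + r) (x i) _ _ (is_derive_cos _) h.
  by move=> hh; apply: is_derive_eq; rewrite /GRing.scale /=; ring.
have hs : is_derive (x i) (1 : R) (fun t => nu * sin (w * t + r)) (nu * (w * cos (w * x i + r))).
  have := @is_derive1_comp R sin (fun y => w * y + r) (x i) _ _ (is_derive_sin _) h.
  by move=> hh; apply: is_derive_eq; rewrite /GRing.scale /=; ring.
rewrite (_ : (fun t => complex.Re _) = (fun t => nu * cos (w * t + r))); last first.
  by apply/funext => t /=; rewrite Er mul0r subr0.
rewrite (_ : (fun t => complex.Im _) = (fun t => nu * sin (w * t + r))); last first.
  by apply/funext => t /=; rewrite Er mul0r addr0.
rewrite !derive1E; have [_ ->] := hc; have [_ ->] := hs.
by apply/eqP; rewrite eq_complex /=; apply/andP; split; apply/eqP; ring.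
Qed.

End ComplexIntegral.

(** * Fourier coefficients *)

Section Coefficients.
Context {R : realType}.
Implicit Types (l n : nat).

(** Two integrations by parts double the weight 96 to 192, and adding the squares of the real and
    imaginary parts gives the outer 2. The same constant dominates the [2 * 12 ^+ 2] of the flat
    bound. *)
Notation T0 := (2 * 192 ^+ 2 : R).

Definition fcoef l (k : int) (e : bool) (q : int) : R[i] :=
  I01c (fun x : R => (theta l k e x)%:C * expi q x).

Lemma normc_sq (z : R[i]) : ComplexField.Normc.normc z ^+ 2 =
  complex.Re z ^+ 2 + complex.Im z ^+ 2.
Proof. by case: z => a b /=; rewrite sqr_sqrtr // addr_ge0 // sqr_ge0. Qed.

Lemma fcoef_spec l (k : int) (e : bool) (q : int) :
  (2 <= l)%N -> 0 <= k -> k < (2 ^ l)%:Z ->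
  [/\ bmeasc (fun x : R => (theta l k e x)%:C * expi q x),
      bmeasc (fun x : R => (derive1 (theta l k e) x)%:C * expi q x),
      I01c (fun x : R => (derive1 (theta l k e) x)%:C * expi q x)
        = (0 +i* (2 * pi * q%:~R))%C * fcoef l k e q,
      ComplexField.Normc.normc (fcoef l k e q) ^+ 2 <= T0 / 2 ^+ l
    & ComplexField.Normc.normc (fcoef l k e q) ^+ 2 * q%:~R ^+ 4
        <= T0 * (2 ^+ l) ^+ 3].
Proof.
move=> l2 k0 k1; have [f [thf f01 hf]] := @theta_hrep R l k e l2 k0 k1.
have mf := hrep_bmeas _ _ _ hf; have [s [fs Ws Bs]] := hf.
have ths x : 0 < x < 1 -> theta l k e x = hsum s x by move=> hx; rewrite thf // fs.
have s01 : hsum s 0 = hsum s 1 by rewrite -!fs.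
set th := theta l k e.
have mth : bmeas th by apply: eq_bmeas mf => x hx; rewrite /th thf.
(* The derivative of [th] equals [hstep s] except at finitely many breakpoints, which integrals do
   not see. *)
have D g : bmeas g -> bmeas (fun x => derive1 th x * g x) /\
    I01 (fun x => derive1 th x * g x) = I01 (fun x => hstep s x * g x).
  move=> hg; apply: (eq_off_seq_I01 (map snd s)); last exact: bmeasM (bmeas_hstep _) hg.
  by move=> x hx xs; rewrite (derive1_hsum _ _ _ hx xs ths).
have mD : bmeas (derive1 th).
  have [h _] := D _ (bmeas_cst 1).
  by apply: eq_bmeas h => x _; rewrite mulr1.
set w : R := 2 * pi * q%:~R.
have mc : bmeas (fun x => cos (w * x)) by exact: bmeas_continuous _ (continuous_cosM _).
have ms : bmeas (fun x => sin (w * x)) by exact: bmeas_continuous _ (continuous_sinM _).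
set Cc := I01 (fun x => hsum s x * cos (w * x)).
set Cs := I01 (fun x => hsum s x * sin (w * x)).
have CE : fcoef l k e q = (Cc +i* - Cs)%C.
  rewrite /fcoef /I01c; congr (_ +i* _)%C.
    by apply: eq_I01 => x hx; rewrite complex_ReM /= mul0r subr0 ths.
  rewrite /Cs -I01N; last exact: bmeasM (bmeas_hsum _) ms.
  by apply: eq_I01 => x hx; rewrite complex_ImM /= mul0r addr0 ths // mulrN.
set S : R := Num.sqrt (2 ^+ l); set M : R := 2 ^+ l.
have M0 : 0 < M by rewrite exprn_gt0.
have Mn0 : M != 0 by exact: lt0r_neq0.
have S0 : 0 <= S by exact: sqrtr_ge0.
have S2 : S ^+ 2 = M by rewrite sqr_sqrtr // ltW.
have bnd g : bmeas g -> (forall x, `|g x| <= 1) ->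
    `|I01 (fun x => hsum s x * g x)| <= 12 * (S / M).
  move=> hg g1; apply: le_trans Bs; apply: le_norm_I01.
  - exact: bmeasM (bmeas_hsum _) hg.
  - exact: bmeas_norm.
  - by move=> x _; rewrite normrM fs ler_piMr.
have Cc1 : `|Cc| <= 12 * (S / M) by apply: bnd => // x; rewrite ler_norml cos_geN1 cos_le1.
have Cs1 : `|Cs| <= 12 * (S / M) by apply: bnd => // x; rewrite ler_norml sin_geN1 sin_le1.
have Cc2 : w ^+ 2 * `|Cc| <= 192 * (S * M).
  apply: le_trans (I01_hsum_cos_le s q w erefl) _.
  by move: Ws; rewrite -/S -/M; lra.
have Cs2 : w ^+ 2 * `|Cs| <= 192 * (S * M).
  apply: le_trans (I01_hsum_sin_le s q w s01 erefl) _.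
  by move: Ws; rewrite -/S -/M; lra.
(* As [2 * pi] is at least 1, decay in [w] implies the same decay in [q]. *)
have wq : (q%:~R : R) ^+ 2 <= w ^+ 2.
  rewrite /w exprMn ler_peMl ?sqr_ge0 // exprn_ege1 //.
  by have := pi_ge2 R; lra.
split.
- exact: bmeascM (bmeasc_real _ mth) (bmeasc_expi _).
- exact: bmeascM (bmeasc_real _ mD) (bmeasc_expi _).
(* The real part is the integration by parts against the cosine, which uses [s01]; the imaginary
   part is the one against the sine. *)
- rewrite CE /I01c; apply/eqP; rewrite eq_complex /=; apply/andP; split; apply/eqP.
    rewrite mul0r sub0r mulrN opprK -(I01_hstep_cos s q s01).
    have [_ <-] := D _ mc.
    by apply: eq_I01 => x _; rewrite mul0r subr0.
  rewrite mul0r add0r.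
  have [mDs Es] := D _ ms.
  have Hs : I01 (fun x => hstep s x * sin (w * x)) = - (w * Cc) := I01_hstep_sin s q.
  rewrite -[RHS]opprK -Hs -Es -I01N //; apply: eq_I01 => x _.
  by rewrite mul0r addr0 mulrN.
- rewrite normc_sq CE /= sqrrN -(real_normK (num_real Cc)) -(real_normK (num_real Cs)).
  have E : (12 * (S / M)) ^+ 2 = 144 / M by rewrite !exprMn S2 exprVn; field.
  have h1 : `|Cc| ^+ 2 <= 144 / M by rewrite -E; apply: lerXn2r => //; rewrite nnegrE ?(le_trans _ Cc1).
  have h2 : `|Cs| ^+ 2 <= 144 / M by rewrite -E; apply: lerXn2r => //; rewrite nnegrE ?(le_trans _ Cs1).
  have : 0 < M^-1 by rewrite invr_gt0.
  lra.
- rewrite normc_sq CE /= sqrrN -(real_normK (num_real Cc)) -(real_normK (num_real Cs)).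
  have E : (192 * (S * M)) ^+ 2 = 192 ^+ 2 * M ^+ 3 by rewrite !exprMn S2; ring.
  have SM0 : 0 <= 192 * (S * M) by rewrite !mulr_ge0 // ltW.
  have key (c : R) : w ^+ 2 * `|c| <= 192 * (S * M) ->
      `|c| ^+ 2 * q%:~R ^+ 4 <= 192 ^+ 2 * M ^+ 3.
    move=> h; rewrite -E (_ : `|c| ^+ 2 * _ = (q%:~R ^+ 2 * `|c|) ^+ 2); last by ring.
    apply: lerXn2r; rewrite ?nnegrE //; first by rewrite mulr_ge0 ?sqr_ge0.
    by apply: le_trans h; exact: ler_wpM2r.
  have := key _ Cc2; have := key _ Cs2; rewrite mulrDl; lra.
Qed.

Lemma aform_fcoef n l (k : 'I_n -> int) (e : 'I_n -> bool) (q : 'I_n -> int)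
    (eta rho : R) (beta : 'I_n -> R) :
  (2 <= l)%N -> (forall i, 0 <= k i /\ k i < (2 ^ l)%:Z) ->
  aform eta beta rho (psi_iso_hat l k e) (xi_hat q) =
  ((2 ^+ l)^-1 * (Num.sqrt (1 + (2 * pi) ^+ 2 * qnorm2sq R q))^-1)%:C *
  ((eta * ((2 * pi) ^+ 2 * qnorm2sq R q) + rho) +i*
   (2 * pi * \sum_(i < n) beta i * (q i)%:~R))%C *
  \prod_(j < n) fcoef l (k j) (e j) (q j).
Proof.
move=> l2 hk.
have sp j := fcoef_spec l (k j) (e j) (q j) l2 (hk j).1 (hk j).2.
set nu := (Num.sqrt _)^-1; set c : R := (2 ^+ l)^-1.
pose w (i : 'I_n) : R[i] := (0 +i* (2 * pi * (q i)%:~R))%C.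
(* The integrand is a sum of separable terms indexed by an option: [None] is the [rho] term, and
   [Some i] joins the [eta] and [beta] terms, which both differentiate the wavelet in direction
   [i]. *)
pose g (o : option 'I_n) (j : 'I_n) (x : R) : R[i] :=
  (if o == Some j then derive1 (theta l (k j) (e j)) x else theta l (k j) (e j) x)%:C
  * expi (q j) x.
(* The factor [conjc (w i)] comes from differentiating the conjugated character; a further [w i]
   arises in [E1] from integrating by parts, and together they produce [(2 pi)^2 |q|^2]. *)
pose a (o : option 'I_n) : R[i] := (c * nu)%:C *
  (if o is Some i then eta%:C * conjc (w i) + (beta i)%:C else rho%:C).
rewrite /aform (cintD_separable _ (None :: map Some (index_enum 'I_n)) n a g).
- rewrite big_cons big_map /=.
  have E0 : \prod_(j < n) I01c (g None j) = \prod_(j < n) fcoef l (k j) (e j) (q j).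
    by apply: eq_bigr => j _.
  have E1 i : \prod_(j < n) I01c (g (Some i) j) =
      w i * \prod_(j < n) fcoef l (k j) (e j) (q j).
    rewrite (bigD1 i) //= [in RHS](bigD1 i) //= mulrA; congr (_ * _).
      by rewrite /g; case: (sp i) => _ _ <- _ _; rewrite eqxx.
    apply: eq_bigr => j ji; rewrite /g /fcoef (_ : (Some i == Some j) = false) //.
    by apply/negbTE; apply: contra ji => /eqP[->].
  rewrite E0; under eq_bigr do rewrite E1 mulrA.
  rewrite -mulr_suml -mulrDl; congr (_ * _).
  have Ea i : a (Some i) * w i =
      (c * nu)%:C * ((eta%:C * conjc (w i) + (beta i)%:C) * w i) by rewrite mulrA.
  rewrite [a None]/a; rewrite (eq_bigr _ (fun i _ => Ea i)).
  rewrite -mulr_sumr -mulrDr; congr (_ * _).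
  have Es i : (eta%:C * conjc (w i) + (beta i)%:C) * w i =
      eta%:C * (conjc (w i) * w i) + (beta i)%:C * w i by rewrite mulrDl mulrA.
  rewrite (eq_bigr _ (fun i _ => Es i)).
  rewrite big_split /= -mulr_sumr.
  have Ew : \sum_(i < n) conjc (w i) * w i = ((2 * pi) ^+ 2 * qnorm2sq R q)%:C.
    rewrite /qnorm2sq mulr_sumr rmorph_sum /=; apply: eq_bigr => i _.
    rewrite /w; apply/eqP; rewrite eq_complex /=; apply/andP; split; apply/eqP; ring.
  have Eb : \sum_(i < n) (beta i)%:C * w i =
      (0 +i* (2 * pi * \sum_(i < n) beta i * (q i)%:~R))%C.
    rewrite mulr_sumr; elim/big_rec2: _ => [//|i y1 y2 _ ->].
    by rewrite /w; apply/eqP; rewrite eq_complex /=; apply/andP; split; apply/eqP; ring.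
  rewrite Ew Eb; apply/eqP; rewrite eq_complex /=; apply/andP; split; apply/eqP; ring.
- move=> o j; rewrite /g; case: (sp j) => h1 h2 _ _ _.
  by case: (o == Some j).
- move=> x; rewrite big_cons big_map.
  have Ev : conjc (xi_hat q x) = nu%:C * \prod_(j < n) expi (q j) (x j).
    by rewrite /xi_hat rmorphM /= -expi_prod -/nu oppr0.
  have Eu : psi_iso_hat l k e x = c%:C * \prod_(j < n) (theta l (k j) (e j) (x j))%:C.
    by rewrite /psi_iso_hat rmorphM /psi_iso rmorph_prod.
  have Ed i : pd i (psi_iso_hat l k e) x = c%:C * \prod_(j < n)
      (if Some i == Some j then derive1 (theta l (k j) (e j)) (x j)
       else theta l (k j) (e j) (x j))%:C.
    rewrite pd_psi_iso_hat rmorphM rmorph_prod; congr (_ * _).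
    apply: eq_bigr => j _; congr (_%:C).
    by rewrite (_ : (Some i == Some j) = (j == i)) // eq_sym.
  have Eg o : a o * \prod_(j < n) g o j (x j) = (a o * \prod_(j < n)
      (if o == Some j then derive1 (theta l (k j) (e j)) (x j)
       else theta l (k j) (e j) (x j))%:C) * \prod_(j < n) expi (q j) (x j).
    by rewrite /g big_split /= mulrA.
  have Edv i : conjc (pd i (xi_hat q) x) =
      conjc (w i) * (nu%:C * \prod_(j < n) expi (q j) (x j)).
    have -> : conjc (pd i (xi_hat q) x) = conjc (w i) * conjc (xi_hat q x).
      by rewrite pd_xi_hat; exact: rmorphM.
    by rewrite Ev.
  have Et i : eta%:C * (pd i (psi_iso_hat l k e) x * conjc (pd i (xi_hat q) x)) +
      (beta i)%:C * pd i (psi_iso_hat l k e) x * conjc (xi_hat q x) =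
      a (Some i) * \prod_(j < n) g (Some i) j (x j).
    by rewrite Eg Ed Edv Ev /a rmorphM; ring.
  have En : rho%:C * psi_iso_hat l k e x * conjc (xi_hat q x) =
      a None * \prod_(j < n) g None j (x j).
    by rewrite Eg Eu Ev /a rmorphM; ring.
  rewrite En mulr_sumr [X in _ + X + _ = _]mulr_suml -big_split.
  by rewrite (eq_bigr _ (fun i _ => Et i)) addrC.
Qed.

End Coefficients.

(** * Estimates *)

Section Estimates.
Context {R : realType}.
Implicit Types (l n : nat).

(** The sum of the squares of [C * b i - D * c i] equals [C * (B * C - D ^+ 2)], and [C] is
    positive. *)
Lemma cauchy_schwarz_sum n (b c : 'I_n -> R) : 0 < \sum_(i < n) c i ^+ 2 ->
  (\sum_(i < n) b i * c i) ^+ 2 <= (\sum_(i < n) b i ^+ 2) * \sum_(i < n) c i ^+ 2.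
Proof.
set B := \sum_(i < n) b i ^+ 2; set C := \sum_(i < n) c i ^+ 2; set D := \sum_(i < n) _.
move=> C0; have : 0 <= \sum_(i < n) (C * b i - D * c i) ^+ 2.
  by apply: sumr_ge0 => i _; exact: sqr_ge0.
rewrite (eq_bigr (fun i => C ^+ 2 * b i ^+ 2 - 2 * C * D * (b i * c i) + D ^+ 2 * c i ^+ 2)).
  rewrite big_split sumrB /= -!mulr_sumr -/B -/C -/D.
  rewrite (_ : _ + _ = C * (B * C - D ^+ 2)); last by ring.
  by rewrite pmulr_rge0 // subr_ge0.
by move=> i _; ring.
Qed.

(** With [P] for [(2 pi)^2] and [Q] for the squared norm of the frequency, the left side is the
    squared modulus of the symbol of the form after normalization of the character. The proof drops
    the 1 in [1 + P * Q], splits the square by [(x + y)^2 <= 2 x^2 + 2 y^2], and absorbs lower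
    powers of [P]. *)
Lemma symbol_le (P Q eta rho b D : R) : 1 <= P -> 0 < Q -> 0 <= b -> D ^+ 2 <= b * Q ->
  (1 + P * Q)^-1 * ((eta * (P * Q) + rho) ^+ 2 + P * D ^+ 2) <=
  2 * P * (Q * (eta ^+ 2 + b / Q + rho ^+ 2 / Q ^+ 2)).
Proof.
move=> P1 Q0 b0 hD; have Qn0 : Q != 0 by exact: lt0r_neq0.
have PQ0 : 0 < P * Q by apply: mulr_gt0 => //; lra.
have E : Q * (eta ^+ 2 + b / Q + rho ^+ 2 / Q ^+ 2) = eta ^+ 2 * Q + b + rho ^+ 2 / Q by field.
rewrite E ler_pdivrMl; last by lra.
set X := eta ^+ 2 * Q + b + rho ^+ 2 / Q.
have X0 : 0 <= X.
  rewrite /X !addr_ge0 //; first by rewrite mulr_ge0 ?sqr_ge0 // ltW.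
  by rewrite divr_ge0 ?sqr_ge0 // ltW.
have QX : Q * X = eta ^+ 2 * Q ^+ 2 + b * Q + rho ^+ 2 by rewrite /X; field.
apply: (@le_trans _ _ (P * Q * (2 * P * X))); last first.
  apply: ler_wpM2r; last by lra.
  by rewrite !mulr_ge0 //; lra.
rewrite (_ : P * Q * _ = 2 * P ^+ 2 * (Q * X)); last by ring.
rewrite QX.
have h1 : (eta * (P * Q) + rho) ^+ 2 <= 2 * (P ^+ 2 * (eta ^+ 2 * Q ^+ 2)) + 2 * rho ^+ 2.
  rewrite -subr_ge0 (_ : _ - _ = (eta * (P * Q) - rho) ^+ 2); last by ring.
  exact: sqr_ge0.
have h2 : P * D ^+ 2 <= P * (b * Q) by apply: ler_wpM2l => //; lra.
have bQ0 : 0 <= b * Q by rewrite mulr_ge0 // ltW.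
have P2 : P <= P ^+ 2 by rewrite expr2 ler_peMl //; lra.
have h3 : P * (b * Q) <= P ^+ 2 * (b * Q) by exact: ler_wpM2r.
have h4 : rho ^+ 2 <= P ^+ 2 * rho ^+ 2 by rewrite ler_peMl ?sqr_ge0 //; lra.
have h5 : 0 <= P ^+ 2 * (b * Q) by rewrite mulr_ge0 ?sqr_ge0.
by rewrite !mulrDr -!mulrA; lra.
Qed.

Lemma prod_support n (q : 'I_n -> int) (u : 'I_n -> R) (v : R) :
  \prod_(j < n) (if q j != 0 then u j else v) =
  (\prod_(j < n | q j != 0) u j) * v ^+ (n - qnorm0 q).
Proof.
rewrite (bigID (fun j => q j != 0)) /=; congr (_ * _).
  by apply: eq_bigr => j ->.
rewrite (eq_bigr (fun=> v)) => [|j /negPf -> //].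
rewrite prodr_const; congr (_ ^+ _).
rewrite -[LHS](addKn (qnorm0 q)); congr (_ - _)%N.
rewrite -[RHS](card_ord n) -(cardC (mem [set i : 'I_n | q i != 0])); congr (_ + _)%N.
by apply: eq_card => j; rewrite !inE.
Qed.

Lemma qnorm0_le n (q : 'I_n -> int) : (qnorm0 q <= n)%N.
Proof. by rewrite /qnorm0 -[X in (_ <= X)%N](card_ord n) max_card. Qed.

(** Both conclusions are weighted geometric means of the hypotheses, with weights 3/4, 1/4 and 1/4,
    3/4. Comparing [a] with [M] avoids fractional powers: one hypothesis alone suffices in each
    case. *)
Lemma decay_interp (N T M a : R) : 0 < M -> 0 < a -> 0 <= T ->
  N <= T / M -> N * a ^+ 4 <= T * M ^+ 3 ->
  N <= T * a^-1 /\ N <= T * (M ^+ 2 / a ^+ 3).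
Proof.
move=> M0 a0 T0 h1 h2.
have h2' : N <= T * M ^+ 3 / a ^+ 4 by rewrite ler_pdivlMr // exprn_gt0.
have [aM|/ltW Ma] := leP a M.
  split.
    by apply: le_trans h1 _; apply: ler_wpM2l => //; rewrite lef_pV2.
  apply: le_trans h1 _; apply: ler_wpM2l => //.
  rewrite ler_pdivlMr ?exprn_gt0 // ler_pdivrMl // -exprS.
  by apply: lerXn2r => //; rewrite nnegrE ltW.
split; apply: (le_trans h2'); rewrite -mulrA; apply: ler_wpM2l => //.
  rewrite ler_pdivrMr ?exprn_gt0 // [a ^+ 4]exprS mulKf ?lt0r_neq0 //.
  by apply: lerXn2r => //; rewrite nnegrE ltW.
rewrite ler_pdivrMr ?exprn_gt0 // (_ : M ^+ 2 / a ^+ 3 * a ^+ 4 = M ^+ 2 * a).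
  by rewrite exprSr ler_wpM2l ?sqr_ge0.
by field; exact: lt0r_neq0.
Qed.

(** The power grows with the level when [z] is nonnegative and is at most 1 otherwise; the sum of
    both bounds makes the statement independent of the sign. *)
Lemma expz2_le (z : int) (l L : nat) : (l <= L)%N ->
  (2 : R) ^ (z * l%:Z) <= 1 + (2 : R) ^ (z * L%:Z).
Proof.
move=> lL; case: z => m.
  rewrite -!PoszM -!exprnP.
  apply: (@le_trans _ _ (2 ^+ (m * L))); last by rewrite lerDr.
  by apply: ler_weXn2l; [lra|rewrite leq_mul2l lL orbT].
rewrite NegzE !mulNr -!PoszM -!exprnN.
apply: (@le_trans _ _ 1); last by rewrite lerDl invr_ge0 exprn_ge0.
by rewrite invf_le1 ?exprn_gt0 // exprn_ege1 //; lra.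
Qed.

Lemma expz2_split (l n q0 : nat) : (q0 <= n)%N ->
  ((2 ^+ l) ^+ 2)^-1 * (((2 ^+ l) ^+ 3) ^+ q0 * ((2 ^+ l)^-1) ^+ (n - q0)) =
  (2 : R) ^ ((4 * q0%:Z - n%:Z - 2) * l%:Z).
Proof.
move=> qn; set d := (n - q0)%N; have {qn}-> : n = (q0 + d)%N by rewrite /d subnKC.
have -> : (4 * q0%:Z - (q0 + d)%:Z - 2) * l%:Z = (3 * q0 * l)%:Z - ((d + 2) * l)%:Z.
  by rewrite PoszD !PoszM PoszD; ring.
rewrite expfzDr ?pnatr_eq0 // -exprnP -exprnN.
rewrite -!exprM exprVn -!exprM mulrC -mulrA; congr (_ * _).
  by congr (_ ^+ _); ring.
rewrite -invfM -exprD; congr (_ ^-1); congr (_ ^+ _).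
by rewrite -mulnDr mulnC.
Qed.

Lemma qnorminf_attained n (q : 'I_n -> int) : (exists i, q i <> 0) ->
  exists2 i, q i != 0 & qnorminf R q = `|(q i)%:~R|.
Proof.
move=> [i0 /eqP qi0].
have h : `|(q i0)%:~R| <= qnorminf R q by exact: le_bigmax.
have p0 : 0 < `|(q i0)%:~R : R| by rewrite normr_gt0 intr_eq0.
(* The maximum starts from the default 0, a value excluded afterwards by the nonzero entry [i0]. *)
have [E|[i E]] : qnorminf R q = 0 \/ exists i, qnorminf R q = `|(q i)%:~R|.
- rewrite /qnorminf; elim/big_ind: _ => [|x y hx hy|i _]; [by left| |by right; exists i].
  by case: (leP x y).
- by move: h; rewrite E; lra.
- exists i => //; move: h; rewrite E -(intr_eq0 R) -normr_gt0; exact: lt_le_trans.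
Qed.

End Estimates.

(** * Products of the coefficient bounds over all coordinates *)

Section ProductBounds.
Context {R : realType} (n l : nat) (q : 'I_n -> int) (N : 'I_n -> R) (T : R).
Let M : R := 2 ^+ l.
Context (T0 : 0 <= T) (N0 : forall j, 0 <= N j).
Context (NM : forall j, N j <= T / M).
Context (Nq : forall j, N j * (q j)%:~R ^+ 4 <= T * M ^+ 3).

Let M0 : 0 < M. Proof. exact: exprn_gt0. Qed.

Let prod_le (t : 'I_n -> R) : (forall j, N j <= T * t j) ->
  \prod_(j < n) N j <= T ^+ n * \prod_(j < n) t j.
Proof.
move=> h; rewrite -[X in T ^+ X](card_ord n) -prodr_const -big_split /=.
by apply: ler_prod => j _; rewrite N0 h.
Qed.

Lemma prod_le_flat : (M ^+ 2)^-1 * \prod_(j < n) N j <= T ^+ n * (2 ^+ ((2 + n) * l))^-1.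
Proof.
have := prod_le (fun=> M^-1) NM; rewrite prodr_const card_ord => h.
apply: le_trans (ler_wpM2l _ h) _; first by rewrite invr_ge0 exprn_ge0 // ltW.
rewrite mulrCA exprVn -invfM -exprD -exprM mulnC //.
Qed.

(** The decay bound is used at each nonzero entry and the flat bound at each zero entry; [M] then
    carries the exponent [3 q0 - (n - q0) - 2]. *)
Lemma prod_le_decay : (M ^+ 2)^-1 * \prod_(j < n) N j <=
  T ^+ n * ((2 : R) ^ ((4 * (qnorm0 q)%:Z - n%:Z - 2) * l%:Z) / qhatpow R q 4).
Proof.
have := prod_le (fun j => if q j != 0 then M ^+ 3 / `|(q j)%:~R| ^+ 4 else M^-1).
rewrite prod_support => h.
have {}h := h _.
apply: le_trans (ler_wpM2l _ (h _)) _.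
- by rewrite invr_ge0 exprn_ge0 // ltW.
- move=> j; case: ifPn => // qj.
  have a0 : 0 < `|(q j)%:~R : R| by rewrite normr_gt0 intr_eq0.
  rewrite mulrA ler_pdivlMr ?exprn_gt0 //.
  by rewrite -normrX (ger0_norm (_ : 0 <= _ ^+ 4)) // (exprM _ 2 2) sqr_ge0.
- rewrite mulrCA; apply: ler_wpM2l; first exact: exprn_ge0.
  rewrite -expz2_split ?qnorm0_le // big_split /= prodr_const prodfV.
  rewrite (_ : #|_| = qnorm0 q); last by apply: eq_card => j; rewrite !inE.
  rewrite -/(qhatpow R q 4) le_eqVlt; apply/orP; left; apply/eqP.
  by rewrite -/M; ring.
Qed.

(** Nonzero entries contribute the level-free bound [1 / |q_j|], except [q_i], which contributes
    [M^2 / |q_i|^3]: its [M^2] exactly cancels the normalization of the wavelet. *)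
Lemma prod_le_max (i : 'I_n) : q i != 0 -> (M ^+ 2)^-1 * \prod_(j < n) N j <=
  T ^+ n * ((M ^+ (n - qnorm0 q))^-1 / (`|(q i)%:~R| ^+ 2 * qhatpow R q 1)).
Proof.
move=> qi0; have Mn0 : M != 0 by exact: lt0r_neq0.
have a0 j : q j != 0 -> 0 < `|(q j)%:~R : R| by move=> qj; rewrite normr_gt0 intr_eq0.
have an0 j : q j != 0 -> `|(q j)%:~R : R| != 0 by move=> /a0; exact: lt0r_neq0.
have := prod_le (fun j => if q j != 0 then
   (if j == i then M ^+ 2 / `|(q j)%:~R| ^+ 2 else 1) * `|(q j)%:~R|^-1 else M^-1).
rewrite prod_support => h.
have {}h := h _.
apply: le_trans (ler_wpM2l _ (h _)) _.
- by rewrite invr_ge0 exprn_ge0 // ltW.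
- move=> j; case: ifPn => // qj.
  have Nq' : N j * `|(q j)%:~R| ^+ 4 <= T * M ^+ 3.
    by rewrite -normrX (ger0_norm (_ : 0 <= _ ^+ 4)) // (exprM _ 2 2) sqr_ge0.
  have [h1 h2] := decay_interp _ _ _ _ M0 (a0 _ qj) T0 (NM j) Nq'.
  case: eqP => _; last by rewrite mul1r.
  by rewrite -mulrA -invfM -exprSr.
- rewrite mulrCA; apply: ler_wpM2l; first exact: exprn_ge0.
  rewrite big_split /= (bigD1 i) //= eqxx big1 => [|j /andP[_ /negPf ->] //].
  rewrite prodfV exprVn le_eqVlt; apply/orP; left; apply/eqP.
  have -> : \prod_(j < n | q j != 0) `|(q j)%:~R : R| = qhatpow R q 1.
    by apply: eq_bigr => j _; rewrite expr1.
  have qh : qhatpow R q 1 != 0 by apply/prodf_neq0 => j qj; rewrite expf_neq0 ?an0.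
  field; rewrite qh Mn0 an0 ?expf_neq0 //.
Qed.

End ProductBounds.

(** * Assembly of the bounds *)

Theorem theorem4p11 (R : realType) :
  exists c : R, 0 < c /\
  forall (n l0 L : nat) (eta rho : R) (beta : 'I_n -> R),
    (1 < n)%N -> (2 <= l0)%N -> (l0 < L)%N ->
    mu_le l0 L eta beta rho (fun _ => 0%R)
      (c ^+ n * (`|rho| ^+ 2 * (2 ^+ ((2 + n) * l0))^-1))
    /\
    forall q : 'I_n -> int, (exists i, q i <> 0%R) ->
      let Q := @qnorm2sq R n q in
      let q0 := qnorm0 q in
      mu_le l0 L eta beta rho q
        (c ^+ n *
          ((`|eta| ^+ 2 + rnorm2sq beta / Q + `|rho| ^+ 2 / Q ^+ 2) *
           Num.min
             ((1 + (2 : R) ^ ((4 * q0%:Z - n%:Z - 2) * L%:Z)) * Q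
                / @qhatpow R n q 4)
             ((2 ^+ ((n - q0) * l0))^-1 * Q
                / (@qnorminf R n q ^+ 2 * @qhatpow R n q 1)))).
Proof.
pose P : R := (2 * pi) ^+ 2; pose T : R := 2 * 192 ^+ 2.
have P1 : 1 <= P by apply: exprn_ege1; have := pi_ge2 R; lra.
have T0 : 0 <= T by rewrite /T mulr_ge0 ?sqr_ge0.
have T1 : 0 < T by rewrite /T mulr_gt0 ?exprn_gt0.
have P0 : 0 < P by exact: lt_le_trans ltr01 P1.
have P2 : 1 <= 2 * P by lra.
have c0 : 0 < 2 * P * T by rewrite mulr_gt0 // mulr_gt0.
(* Each coordinate costs a factor [T], and the symbol costs [2 * P] once, which is at most its
   [n]-th power. *)
exists (2 * P * T); split => // n l0 L eta rho beta n1 l02 l0L.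
have cT : 2 * P * T ^+ n <= (2 * P * T) ^+ n.
  rewrite [in leRHS]exprMn ler_wpM2r ?exprn_ge0 // ler_eXnr //.
  exact: ltnW.
have Tc : T ^+ n <= (2 * P * T) ^+ n.
  by apply: lerXn2r; rewrite ?nnegrE //; [exact: ltW|rewrite ler_peMl].
(* The squared modulus factors into the normalized symbol, which depends only on [q], and the
   product of Fourier coefficients together with the squared normalization of the wavelet. *)
have key q l k e : Jiso l0 L l k ->
    let N j := ComplexField.Normc.normc (@fcoef R l (k j) (e j) (q j)) ^+ 2 in
    [/\ (2 <= l)%N, forall j, 0 <= N j, forall j, N j <= T / 2 ^+ l,
      forall j, N j * (q j)%:~R ^+ 4 <= T * (2 ^+ l) ^+ 3 &
      ComplexField.Normc.normc (aform eta beta rho (psi_iso_hat l k e) (xi_hat q)) ^+ 2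
      = (1 + P * qnorm2sq R q)^-1 * ((eta * (P * qnorm2sq R q) + rho) ^+ 2
          + P * (\sum_(i < n) beta i * (q i)%:~R) ^+ 2) *
        (((2 ^+ l) ^+ 2)^-1 * \prod_(j < n) N j)].
  move=> [/andP[l0l lL] hk] N; have l2 : (2 <= l)%N by exact: leq_trans l0l.
  have sp j := @fcoef_spec R l (k j) (e j) (q j) l2 (hk j).1 (hk j).2.
  split => //.
  - by move=> j; exact: sqr_ge0.
  - by move=> j; case: (sp j).
  - by move=> j; case: (sp j).
  rewrite aform_fcoef // -/P !ComplexField.Normc.normcM !exprMn.
  have -> : ComplexField.Normc.normc (\prod_(j < n) fcoef l (k j) (e j) (q j)) ^+ 2 = \prod_(j < n) N j.
    elim/big_rec2: _ => [|j y1 y2 _ <-]; first by rewrite ComplexField.Normc.normc1 expr1n.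
    by rewrite ComplexField.Normc.normcM exprMn.
  rewrite !normc_sq /= expr0n addr0 [(2 * pi * _) ^+ 2]exprMn -/P.
  rewrite [(_^-1 * _^-1) ^+ 2]exprMn !exprVn sqr_sqrtr; last first.
    rewrite addr_ge0 // mulr_ge0 ?(ltW P0) //.
    by apply: sumr_ge0 => i _; exact: sqr_ge0.
  by ring.
split.
  (* At frequency zero the symbol is just [rho], and the flat bound decreases in the level, so the
     worst level is [l0]. *)
  move=> l k e hJ; have [l2 N0 NM Nq ->] := key (fun=> 0) l k e hJ.
  have -> : qnorm2sq R (fun _ : 'I_n => 0) = 0.
    by rewrite /qnorm2sq big1 // => i _; rewrite expr0n.
  rewrite [\sum_(i < n) _]big1 => [|i _]; last by rewrite mulr0.
  rewrite !mulr0 addr0 invr1 mul1r add0r expr0n mulr0 addr0 real_normK ?num_real //.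
  have h := prod_le_flat _ _ _ _ N0 NM.
  rewrite [leRHS]mulrCA; apply: ler_wpM2l; first exact: sqr_ge0.
  apply: le_trans h _; apply: ler_pM => //; first by rewrite exprn_ge0.
  rewrite lef_pV2 ?posrE ?exprn_gt0 //; apply: ler_weXn2l; first by lra.
  by rewrite leq_mul2l; case: hJ => /andP[-> _] _; rewrite orbT.
move=> q hq Q q0 l k e hJ; have [l2 N0 NM Nq ->] := key q l k e hJ.
have [i0 qi0 qinf] := @qnorminf_attained R n q hq.
have Q0 : 0 < Q.
  rewrite /Q /qnorm2sq (bigD1 i0) //= ltr_pwDl //.
    by rewrite lt0r sqrf_eq0 intr_eq0 qi0 sqr_ge0.
  by apply: sumr_ge0 => i _; exact: sqr_ge0.
have b0 : 0 <= rnorm2sq beta by apply: sumr_ge0 => i _; exact: sqr_ge0.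
rewrite !real_normK ?num_real //.
set S := eta ^+ 2 + _ + _.
have S0 : 0 <= S.
  rewrite /S !addr_ge0 ?sqr_ge0 // divr_ge0 ?sqr_ge0 //; exact: ltW.
have hA := symbol_le P Q eta rho (rnorm2sq beta) _ P1 Q0 b0
  (@cauchy_schwarz_sum R n beta (fun i => (q i)%:~R) Q0).
have lL : (l0 <= l)%N /\ (l <= L)%N by case: hJ => /andP[? /ltnW].
have M0 : 0 < (2 ^+ l : R) by exact: exprn_gt0.
have qh p : 0 < qhatpow R q p.
  by apply: prodr_gt0 => j qj; rewrite exprn_gt0 // normr_gt0 intr_eq0.
(* Both entries of the minimum have the form [X * Q], where [Q] comes from the symbol; only a bound
   [X] for the coefficient product remains to be supplied. *)
have fin X : 0 <= X -> ((2 ^+ l) ^+ 2)^-1 * \prod_(j < n)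
     ComplexField.Normc.normc (@fcoef R l (k j) (e j) (q j)) ^+ 2 <= T ^+ n * X ->
   (1 + P * qnorm2sq R q)^-1 * ((eta * (P * qnorm2sq R q) + rho) ^+ 2
          + P * (\sum_(i < n) beta i * (q i)%:~R) ^+ 2) *
        (((2 ^+ l) ^+ 2)^-1 * \prod_(j < n)
          ComplexField.Normc.normc (@fcoef R l (k j) (e j) (q j)) ^+ 2)
   <= (2 * P * T) ^+ n * (S * (X * Q)).
  move=> X0 hX; apply: le_trans (ler_pM _ _ hA hX) _.
  - rewrite mulr_ge0 //.
      by rewrite invr_ge0 addr_ge0 // mulr_ge0 // ltW.
    by rewrite addr_ge0 ?sqr_ge0 // mulr_ge0 ?sqr_ge0 // ltW.
  - rewrite mulr_ge0 ?invr_ge0 ?exprn_ge0 ?(ltW M0) //.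
    by apply: prodr_ge0 => j _; exact: sqr_ge0.
  - rewrite -/S [leLHS](_ : _ = 2 * P * T ^+ n * (S * (X * Q))); last by ring.
    by apply: ler_wpM2r => //; rewrite !mulr_ge0 // ltW.
have hX1 : 0 <= (1 + (2 : R) ^ ((4 * q0%:Z - n%:Z - 2) * L%:Z)) / qhatpow R q 4.
  by rewrite divr_ge0 ?(ltW (qh _)) // addr_ge0 // exprz_ge0.
have hX2 : 0 <= (2 ^+ ((n - q0) * l0))^-1 / (qnorminf R q ^+ 2 * qhatpow R q 1).
  by rewrite divr_ge0 ?invr_ge0 ?exprn_ge0 // mulr_ge0 ?sqr_ge0 // (ltW (qh _)).
have F1 := fin _ hX1; have F2 := fin _ hX2.
rewrite minEle; case: ifP => _.
- rewrite [_ * Q / _]mulrAC; apply: F1.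
  apply: le_trans (prod_le_decay _ _ _ _ _ T0 N0 NM Nq) _.
  apply: ler_wpM2l; first exact: exprn_ge0.
  by apply: ler_wpM2r; [rewrite invr_ge0 ltW|exact: expz2_le lL.2].
- rewrite [_ * Q / _]mulrAC; apply: F2.
  apply: le_trans (prod_le_max _ _ _ _ _ T0 N0 NM Nq i0 qi0) _.
  apply: ler_wpM2l; first exact: exprn_ge0.
  (* The distinguished entry is a maximal one, so its square is the squared maximum norm; the
     remaining negative power of 2 is largest at [l0]. *)
  rewrite qinf; apply: ler_wpM2r.
    by rewrite invr_ge0 mulr_ge0 ?sqr_ge0 // ltW.
  rewrite lef_pV2 ?posrE ?exprn_gt0 // -exprM; apply: ler_weXn2l; first by lra.
  by rewrite mulnC leq_mul2r lL.1 orbT.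
Qed.
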